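(* For every integer $n\geq 1$, the Chow polynomial $H_{\mathrm{NC}_{n+1}}(t)$ of the noncrossing partition lattice $\mathrm{NC}_{n+1}$ is real-rooted, i.e. all of its complex zeros are real.
   Context: $\mathrm{NC}_{N}$ denotes the lattice of noncrossing set partitions of $\{1,\dots,N\}$ ordered by refinement (a partition is noncrossing if there are no $a<b<c<d$ with $a,c$ in one block and $b,d$ in a different block). It is a finite graded bounded poset. Chow polynomial of a finite graded bounded poset $P$ (Ferroni--Matherne--Vecchi): for $s\le w$ in $P$ let $\rho(s,w)$ be the length (rank) of the interval $[s,w]$ and let $\mu$ be the Möbius function of $P$. For $s<w$ put $\chi_{s,w}(t)=\sum_{s\le v\le w}\mu(s,v)\,t^{\rho(v,w)}$ and $\overline{\chi}_{s,w}(t)=\chi_{s,w}(t)/(t-1)$, which is a polynomial. Define polynomials $H_{s,w}(t)$ recursively by $H_{s,s}(t)=1$ and, for $s<w$, $H_{s,w}(t)=\sum_{s<v\le w}\overline{\chi}_{s,v}(t)\,H_{v,w}(t)$. The Chow polynomial of $P$ is $H_P(t)=H_{\hat 0,\hat 1}(t)$, where $\hat0$ and $\hat1$ are the minimum and maximum of $P$. Nonzero constant polynomials are considered real-rooted. *)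

(* Defs.v *)
From HB Require Import structures.
From mathcomp Require Import all_boot all_order all_algebra.
From mathcomp Require Import reals.
From mathcomp Require Import complex.

Set Implicit Arguments.
Unset Strict Implicit.
Unset Printing Implicit Defensive.

Import Order.TTheory GRing.Theory Num.Theory.
Local Open Scope ring_scope.

Section FinitePosets.
Context {d : Order.disp_t} {P : finPOrderType d}.
Implicit Types s v w : P.

Definition is_chain (A : {set P}) : bool :=
  [forall x in A, forall y in A, (x >=< y)%O].

Definition interval_rank s w : nat :=
  \max_(A : {set P} | is_chain A && [forall x in A, (s <= x <= w)%O]) #|A|.-1.

(* The recursion is on a fuel argument; #|P| units of fuel always suffice, so
   that the defining recurrence holds unconditionally: see mobius_lt. *)
Fixpoint mobius_rec (k : nat) s w : int :=
  if s == w then 1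
  else if k is k'.+1 then - \sum_(v | (s <= v < w)%O) mobius_rec k' s v
  else 0.

Definition mobius s w : int := mobius_rec #|P| s w.

Definition poset_charpoly s w : {poly int} :=
  \sum_(v | (s <= v <= w)%O) mobius s v *: 'X^(interval_rank v w).

(* The division is exact for s < w: see reduced_charpolyK. *)
Definition reduced_charpoly s w : {poly int} := poset_charpoly s w %/ ('X - 1).

(* Same use of fuel as for mobius_rec; the recurrence is chow_lt. *)
Fixpoint chow_rec (k : nat) s w : {poly int} :=
  if s == w then 1
  else if k is k'.+1 then
    \sum_(v | (s < v <= w)%O) reduced_charpoly s v * chow_rec k' v w
  else 0.

Definition chow s w : {poly int} := chow_rec #|P| s w.

Lemma mobius_rec_stable k1 k2 s w :
    (#|[set v | (s <= v < w)%O]| <= k1)%N ->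
    (#|[set v | (s <= v < w)%O]| <= k2)%N ->
  mobius_rec k1 s w = mobius_rec k2 s w.
Proof.
have empty u : s != u -> (#|[set v | (s <= v < u)%O]| <= 0)%N ->
    forall k, mobius_rec k s u = 0.
  move=> su; rewrite leqn0 cards_eq0 => /eqP E [|k] /=; rewrite (negPf su) //.
  by rewrite big_pred0 ?oppr0 // => v; move/setP/(_ v): E; rewrite !inE.
elim: k1 k2 w => [|k1 IH] k2 w h1 h2; have [->|sw] := eqVneq s w.
- by case: k2 {h2} => [|k2] /=; rewrite eqxx.
- by rewrite !(empty w).
- by case: k2 {h2} => [|k2] /=; rewrite eqxx.
- case: k2 h2 => [|k2] h2; first by rewrite !(empty w).
  rewrite /= (negPf sw); congr (- _); apply: eq_bigr => v /andP[sv vw].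
  have lt_card : (#|[set u | (s <= u < v)%O]| < #|[set u | (s <= u < w)%O]|)%N.
    apply: proper_card; apply/properP; split.
      by apply/subsetP => u; rewrite !inE => /andP[-> /lt_trans->].
    by exists v; rewrite !inE ?sv ?vw // ltxx andbF.
  by apply: IH; rewrite -ltnS; apply: leq_trans lt_card _.
Qed.

Lemma mobius_refl s : mobius s s = 1.
Proof. by rewrite /mobius; case: #|P| => [|k] /=; rewrite eqxx. Qed.

Lemma mobius_lt s w : (s < w)%O ->
  mobius s w = - \sum_(v | (s <= v < w)%O) mobius s v.
Proof.
move=> sw; rewrite {1}/mobius (@mobius_rec_stable _ #|P|.+1) ?max_card //=.
  by rewrite (lt_eqF sw).
exact: leqW (max_card _).
Qed.

Lemma chow_rec_stable k1 k2 s w :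
    (#|[set v | (s < v <= w)%O]| <= k1)%N ->
    (#|[set v | (s < v <= w)%O]| <= k2)%N ->
  chow_rec k1 s w = chow_rec k2 s w.
Proof.
have empty u : u != w -> (#|[set v | (u < v <= w)%O]| <= 0)%N ->
    forall k, chow_rec k u w = 0.
  move=> su; rewrite leqn0 cards_eq0 => /eqP E [|k] /=; rewrite (negPf su) //.
  by rewrite big_pred0 // => v; move/setP/(_ v): E; rewrite !inE.
elim: k1 k2 s => [|k1 IH] k2 s h1 h2; have [->|sw] := eqVneq s w.
- by case: k2 {h2} => [|k2] /=; rewrite eqxx.
- by rewrite !(empty s).
- by case: k2 {h2} => [|k2] /=; rewrite eqxx.
- case: k2 h2 => [|k2] h2; first by rewrite !(empty s).
  rewrite /= (negPf sw); apply: eq_bigr => v /andP[sv vw]; congr (_ * _).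
  have lt_card : (#|[set u | (v < u <= w)%O]| < #|[set u | (s < u <= w)%O]|)%N.
    apply: proper_card; apply/properP; split.
      by apply/subsetP => u; rewrite !inE => /andP[/(lt_trans sv)-> ->].
    by exists v; rewrite !inE ?sv ?vw // ltxx.
  by apply: IH; rewrite -ltnS; apply: leq_trans lt_card _.
Qed.

Lemma chow_refl s : chow s s = 1.
Proof. by rewrite /chow; case: #|P| => [|k] /=; rewrite eqxx. Qed.

Lemma chow_lt s w : (s < w)%O ->
  chow s w = \sum_(v | (s < v <= w)%O) reduced_charpoly s v * chow v w.
Proof.
move=> sw; rewrite {1}/chow (@chow_rec_stable _ #|P|.+1) ?max_card //=.
  by rewrite (lt_eqF sw).
exact: leqW (max_card _).
Qed.

Lemma reduced_charpolyK s w : (s < w)%O ->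
  reduced_charpoly s w * ('X - 1) = poset_charpoly s w.
Proof.
move=> sw; rewrite /reduced_charpoly -polyC1.
apply: Pdiv.IdomainUnit.divpK; first by rewrite lead_coefXsubC unitr1.
rewrite dvdp_XsubCl /root /poset_charpoly horner_sum.
under eq_bigr => v _ do rewrite hornerZ hornerXn expr1n mulr1.
rewrite (bigD1 w) /=; last by rewrite lexx (ltW sw).
rewrite mobius_lt // addrC subr_eq0; apply/eqP/eq_bigl => v.
by rewrite lt_neqAle andbA andbAC.
Qed.

End FinitePosets.

Definition chow_poly {d : Order.disp_t} (P : finTBPOrderType d) : {poly int} :=
  chow (\bot : P)%O (\top : P)%O.

Definition noncrossing (N : nat) (p : {set {set 'I_N}}) : bool :=
  [forall B in p, forall C in p, (B != C) ==>
    ~~ [exists a in B, exists b in C, exists c in B, exists e in C,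
         [&& (a < b)%N, (b < c)%N & (c < e)%N]]].

Definition is_nc_partition (N : nat) (p : {set {set 'I_N}}) : bool :=
  partition p [set: 'I_N] && noncrossing p.

Record NC (N : nat) : predArgType :=
  NCPartition { blocks :> {set {set 'I_N}}; _ : is_nc_partition blocks }.

HB.instance Definition _ (N : nat) := [isSub for @blocks N].
HB.instance Definition _ (N : nat) := [Finite of NC N by <:].

Section NoncrossingOrder.
Variable N : nat.
Implicit Types p q r : NC N.

Definition refines p q : bool :=
  [forall B in blocks p, exists C in blocks q, B \subset C].

Lemma blocks_partition p : partition (blocks p) [set: 'I_N].
Proof. by case: p => p /= /andP[]. Qed.

Lemma refinesP p q :
  reflect (forall B, B \in blocks p ->
             exists2 C, C \in blocks q & B \subset C)
          (refines p q).
Proof. by apply: (iffP 'forall_in_exists_inP). Qed.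

Lemma refines_refl : reflexive refines.
Proof. by move=> p; apply/refinesP => B pB; exists B. Qed.

Lemma refines_trans : transitive refines.
Proof.
move=> q p r /refinesP pq /refinesP qr; apply/refinesP => B /pq[C /qr[D rD CD] BC].
by exists D => //; apply: subset_trans CD.
Qed.

Lemma refines_anti : antisymmetric refines.
Proof.
have sub p q : refines p q -> refines q p -> blocks p \subset blocks q.
  move=> /refinesP pq /refinesP qp; apply/subsetP => B pB.
  have [C qC BC] := pq B pB; have [D pD CD] := qp C qC.
  have /and3P[_ /trivIsetP tI n0] := blocks_partition p.
  have BD : B = D.
    apply/eqP; apply: contraNT n0 => /(tI B D pB pD).
    rewrite disjoints_subset => BcD; suff <- : B = set0 by [].
    apply/setP => x; rewrite inE; apply/negP => xB.
    have := subsetP BcD x xB; rewrite inE => /negP; apply.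
    exact: (subsetP (subset_trans BC CD)).
  by suff -> : B = C by []; apply/eqP; rewrite eqEsubset BC BD CD.
move=> p q /andP[pq qp]; apply: val_inj; apply/eqP.
by rewrite eqEsubset; apply/andP; split; apply: sub.
Qed.

Lemma nc_bot_subproof : is_nc_partition (preim_partition (@id 'I_N) [set: 'I_N]).
Proof.
rewrite /is_nc_partition preim_partitionP /=.
apply/'forall_in_forall_inP => B /imsetP[x _ ->] C _.
apply/implyP => _; apply/negP => /'exists_in_exists_inP[a + [b _]].
rewrite !inE /= => /eqP <- /'exists_in_exists_inP[c + [e _]].
rewrite !inE /= => /eqP <- /and3P[ab ba _].
by have := ltn_trans ab ba; rewrite ltnn.
Qed.

Lemma nc_top_subproof :
  is_nc_partition (preim_partition (fun=> tt) [set: 'I_N]).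
Proof.
rewrite /is_nc_partition preim_partitionP /=.
apply/'forall_in_forall_inP => B /imsetP[x _ ->] C /imsetP[y _ ->].
by apply/implyP => /eqP[]; apply/setP => z; rewrite !inE.
Qed.

(* The partition into singletons, and the partition with at most one block
   (it has no block when N = 0). *)
Definition nc_bot : NC N := NCPartition nc_bot_subproof.
Definition nc_top : NC N := NCPartition nc_top_subproof.

Lemma nc_botP p : refines nc_bot p.
Proof.
apply/refinesP => B /imsetP[x _ ->].
have /and3P[/eqP cov _ _] := blocks_partition p.
have /bigcupP[C pC xC] : x \in cover (blocks p) by rewrite cov inE.
by exists C => //; apply/subsetP => y; rewrite !inE /= => /eqP <-.
Qed.

Lemma nc_topP p : refines p nc_top.
Proof.
apply/refinesP => B pB.
have /and3P[_ _ n0] := blocks_partition p.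
have /set0Pn[x xB] : B != set0 by apply: contraNneq n0 => <-.
exists [set: 'I_N]; last exact: subsetT.
by apply/imsetP; exists x => //; apply/setP => y; rewrite !inE.
Qed.

End NoncrossingOrder.

Fact nc_display : Order.disp_t. Proof. exact: Order.Disp tt tt. Qed.

HB.instance Definition _ (N : nat) :=
  Order.Le_isPOrder.Build nc_display (NC N)
    (@refines_refl N) (@refines_anti N) (@refines_trans N).
HB.instance Definition _ (N : nat) :=
  Order.hasBottom.Build nc_display (NC N) (@nc_botP N).
HB.instance Definition _ (N : nat) :=
  Order.hasTop.Build nc_display (NC N) (@nc_topP N).

(* The zero polynomial is not real-rooted in this sense; nonzero constants are. *)
Definition real_rooted (R : realType) (p : {poly int}) : Prop :=
  forall z : R[i], root (map_poly intr p) z -> z \is Num.real.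

(* Main.v *)
Require Import Defs.
From mathcomp Require Import all_boot all_order all_algebra.
From mathcomp Require Import reals.
From mathcomp Require Import complex.
From mathcomp Require Import zify ring lra.

(** Write [N = n + 1].  In the incidence algebra of a graded poset, with
    [kappa s v = X^rho(s, v)], the defining recurrence of the Chow polynomials
    reads [(kappa - X zeta) H = (1 - X) zeta].  To a power series [phi] attach the
    row vector [F_phi v = prod_(C in v) [u^|C|] y] on NC_N, where [y = u phi(y)].
    Cutting a noncrossing partition at the first two elements of its first block
    gives, by Lagrange inversion, [F_phi * q^rho = F_(phi (1 + q u))].  With
    [Psi = (1 + u) / (1 + X u)], the numbers [a_k = sum_v F_(Psi^k) v * H_(v, 1)]
    thus satisfy [a_k = X a_(k+1) + (1 - X) [u^N] y_(k+1)], where [y_k] solves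
    [y = u Psi(y)^k], and [a_0 = H_(0, 1)].
    Unfolding this and expanding [Psi^(N k)] shows that [N H = sum_e X^e c_(N e + 1)],
    where [c_i] is the [i]-th coefficient of
    [(1 + x + .. + x^(N-1))^2 (1 + x + .. + x^(N-2))^(N-2)].

    Such a multisection is real-rooted.  For [Im z > 0], call a sequence [v] of
    complex numbers with [v_(i+N) = z v_i] rotating if the arguments of
    [v_0, .., v_N] are nondecreasing and increase by [arg z] in total.  Sums over
    sliding windows of length [N] or [N - 1] preserve this property as well as the
    nonvanishing of all [v_i], and such windows build the value of [N X H] at [z]
    from the sequence [z^(i/N)] supported on the multiples of [N]. *)

Set Implicit Arguments.
Unset Strict Implicit.
Unset Printing Implicit Defensive.

Import Order.TTheory GRing.Theory Num.Theory.
Local Open Scope ring_scope.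

(** * Lagrange inversion *)

Section Lagrange.
Variable A : comNzRingType.
Implicit Types (phi psi : {poly A}) (m k l : nat).

(* The coefficient of [u^m] in [y^k], where [y = u phi(y)]. *)
Fixpoint lagr phi m k : A :=
  match m, k with
  | 0, 0 => 1
  | m'.+1, k'.+1 => \sum_(s < m'.+1) phi`_s * lagr phi m' (k' + s)
  | _, _ => 0
  end.

Lemma lagr0 phi k : lagr phi 0 k = (k == 0)%:R. Proof. by case: k. Qed.

Lemma lagrS0 phi m : lagr phi m.+1 0 = 0. Proof. by []. Qed.

Lemma lagr_gt phi m k : (m < k)%N -> lagr phi m k = 0.
Proof.
elim: m k => [|m IH] [|k] //= mk; apply: big1 => s _.
by rewrite IH ?mulr0 // ltn_addr.
Qed.

Lemma lagrSS phi m k M : (m < M)%N ->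
  lagr phi m.+1 k.+1 = \sum_(s < M) phi`_s * lagr phi m (k + s).
Proof.
move=> mM; rewrite /= (big_ord_widen M (fun s => phi`_s * lagr phi m (k + s))) //.
rewrite [RHS](bigID (fun s : 'I_M => (s < m.+1)%N)) /= [X in _ + X]big1 ?addr0 //.
by move=> s; rewrite -leqNgt => ms; rewrite lagr_gt ?mulr0 // ltn_addl.
Qed.

Lemma eq_lagr phi psi m k : (forall i, (i < m)%N -> phi`_i = psi`_i) ->
  lagr phi m k = lagr psi m k.
Proof.
elim: m k => [|m IH] [|k] //= e; apply: eq_bigr => s _.
by rewrite e // IH // => i im; rewrite e // ltnW.
Qed.

(** This is [y^k y^l = y^(k + l)], read off at [u^m]. *)
Lemma lagr_conv phi m k l :
  \sum_(i < m.+1) lagr phi i k * lagr phi (m - i) l = lagr phi m (k + l).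
Proof.
elim: m k l => [|m IH] [|k] l.
- by rewrite big_ord_recl big_ord0 /= mul1r addr0.
- by rewrite big_ord_recl big_ord0 /= mul0r addr0.
- by rewrite big_ord_recl big1 /= ?mul1r ?addr0 // => i _; rewrite mul0r.
rewrite big_ord_recl mul0r add0r addSn (@lagrSS _ _ _ m.+1) //.
under eq_bigr => i _.
  rewrite lift0 (@lagrSS _ _ _ m.+1); last by [].
  rewrite subSS big_distrl; over.
rewrite exchange_big; apply: eq_bigr => s _ /=.
under eq_bigr => i _ do rewrite -mulrA.
by rewrite -big_distrr /= IH addnAC.
Qed.

Lemma coef_lagr_exp phi M N b : (N < M)%N ->
  ((\poly_(i < M) lagr phi i 1) ^+ b)`_N = lagr phi N b.
Proof.
elim: b N => [|b IH] N NM; first by rewrite expr0 coef1; case: N {NM}.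
rewrite exprS coefM -[b.+1]add1n -lagr_conv; apply: eq_bigr => i _.
have iM : (i < M)%N by apply: leq_ltn_trans NM; rewrite -ltnS.
by rewrite coef_poly iM IH // (leq_ltn_trans (leq_subr _ _)).
Qed.

(** Both sides are coefficients of [u d/du phi^(m+1) = (m+1) u phi' phi^m]. *)
Lemma coef_XderivM phi m j :
  m.+1%:R * (\sum_(s < j.+1) (s%:R * phi`_s) * (phi ^+ m)`_(j - s))
    = j%:R * (phi ^+ m.+1)`_j.
Proof.
have E p i : ('X * p^`())`_i = i%:R * p`_i :> A.
  by rewrite coefXM; case: i => [|i]; rewrite ?mul0r //= coef_deriv mulr_natl.
rewrite -E deriv_exp mulrnAr coefMn mulr_natl [in RHS]mulrA coefM; congr (_ *+ _).
by apply: eq_bigr => s _; rewrite E.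
Qed.

End Lagrange.

Arguments lagr : simpl never.

Section LagrangeInversion.
Variable A : idomainType.
Hypothesis natA : forall n, (n%:R == 0 :> A) = (n == 0%N).
Implicit Types (phi psi : {poly A}) (m k l : nat).

(** Induction on [m] through [y^(k+1) = u y^k phi(y)]. The induction hypothesis gives each term
    [y^(k+s)] the factor [k + s]: the part with [k] is the convolution for [phi^(m+1)], the part
    with [s] is handled by [coef_XderivM]. *)
Lemma lagr_inversion phi m k : (k <= m)%N ->
  m%:R * lagr phi m k = k%:R * (phi ^+ m)`_(m - k).
Proof.
elim: m k => [|m IH] [|k] km; rewrite ?mul0r ?mulr0 //.
case: m IH km => [|m] IH km.
  move: km; rewrite ltnS leqn0 => /eqP->.
  by rewrite (@lagrSS _ _ _ _ 1) // big_ord_recl big_ord0 lagr0 /= expr1 mulr1 addr0.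
have m0 : m.+1%:R != 0 :> A by rewrite natA.
apply: (mulfI m0); rewrite mulrCA subSS (@lagrSS _ _ _ _ m.+2) // big_distrr /=.
have E : \sum_(s < m.+2) m.+1%:R * (phi`_s * lagr phi m.+1 (k + s)) =
    \sum_(s < (m.+1 - k).+1) (k%:R * (phi`_s * (phi ^+ m.+1)`_(m.+1 - k - s))
       + (s%:R * phi`_s) * (phi ^+ m.+1)`_(m.+1 - k - s)).
  rewrite (big_ord_widen m.+2 (fun s => k%:R * (phi`_s * (phi ^+ m.+1)`_(m.+1 - k - s))
       + (s%:R * phi`_s) * (phi ^+ m.+1)`_(m.+1 - k - s))); last first.
    by rewrite ltnS leq_subr.
  rewrite [LHS](bigID (fun s : 'I_m.+2 => (s < (m.+1 - k).+1)%N)) /=.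
  rewrite [X in _ + X]big1 ?addr0; last first.
    move=> s; rewrite -leqNgt => ms; rewrite lagr_gt ?mulr0 //.
    by rewrite -ltn_subLR // -ltnS.
  apply: eq_bigr => s; rewrite ltnS => ms.
  have h : (k + s <= m.+1)%N by move: (ltn_ord s) km; lia.
  rewrite mulrCA IH // subnDA natrD; ring.
rewrite E big_split /= -big_distrr /= -coefM -exprS mulrDr coef_XderivM.
by rewrite natrB // -!natr1; ring.
Qed.

(* If [y = u phi(y)] and [w = u (1 + q y(w))], then [x = y(w)] solves
   [x = u (1 + q x) phi(x)]; the statement compares coefficients in
   [w = u (1 + q x)]. *)
Lemma lagr_comp phi q M N : (N.+1 < M)%N ->
  lagr (1 + q *: \poly_(i < M) lagr phi i 1) N.+2 1
    = q * lagr (phi * (1 + q *: 'X)) N.+1 1.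
Proof.
move=> NM.
have n1 : N.+1%:R != 0 :> A by rewrite natA.
have n2 : N.+2%:R != 0 :> A by rewrite natA.
apply: (mulfI n1); apply: (mulfI n2).
(* Lagrange inversion turns both sides into coefficients of powers, which are compared power by
   power in [q]. On the left, [q^(b+1)] comes with a coefficient of [y^(b+1)], so a second inversion
   is needed, and the binomials agree by absorption. *)
rewrite [LHS]mulrCA [in RHS](mulrCA N.+1%:R) !lagr_inversion // !mul1r !subSS !subn0.
rewrite exprMn [in RHS]addrC [in LHS]addrC !exprD1n big_distrr !coef_sum !big_distrr.
rewrite big_ord_recl /= expr0 mulr1n coef1 mulr0 add0r.
apply: eq_bigr => b _; rewrite /bump leq0n add1n coefMn exprZn coefZ (coef_lagr_exp _ _ NM).
rewrite mulrnAr exprZn coefMn -scalerAr coefZ coefMXn.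
case: ltnP => bN.
  by rewrite lagr_gt ?ltnS // !(mulr0, mul0rn).
have H := lagr_inversion phi (bN : b.+1 <= N.+1)%N.
rewrite subSS in H.
have B : b.+1%:R * 'C(N.+2, b.+1)%:R = N.+2%:R * 'C(N.+1, b)%:R :> A.
  by rewrite -!natrM -mul_bin_diag.
rewrite -(mulr_natl _ 'C(N.+2, b.+1)) -(mulr_natl _ 'C(N.+1, b)).
transitivity ('C(N.+2, b.+1)%:R * q ^+ b.+1 * (N.+1%:R * lagr phi N.+1 b.+1)).
  by rewrite !mulrA; congr (_ * _); rewrite -mulrA mulrC.
rewrite H; transitivity (b.+1%:R * 'C(N.+2, b.+1)%:R * q ^+ b.+1 * (phi ^+ N.+1)`_(N - b)).
  by rewrite !mulrA; congr (_ * _); rewrite mulrC mulrA.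
by rewrite B exprS -!mulrA; congr (_ * _); rewrite mulrCA.
Qed.
End LagrangeInversion.

(** * Weighted sums over noncrossing partitions *)

Section Partitions.
Variable T : finType.
Implicit Types (P Q : {set {set T}}) (D E B C : {set T}).

Lemma partition_eq_block P D B C x : partition P D -> B \in P -> C \in P ->
  x \in B -> x \in C -> B = C.
Proof.
move=> pP BP CP xB xC; have tI := partition_trivIset pP.
by rewrite -(def_pblock tI BP xB) (def_pblock tI CP xC).
Qed.

Lemma partition_cover P D x : partition P D -> x \in D -> exists2 B, B \in P & x \in B.
Proof. by move=> pP; rewrite -(cover_partition pP) => /bigcupP[B]; exists B. Qed.

Lemma partition_mem P D B x : partition P D -> B \in P -> x \in B -> x \in D.
Proof. by move=> pP /(partitionS pP)/subsetP; apply. Qed.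

Lemma partitionI P D :
    (forall B, B \in P -> B != set0) -> (forall B, B \in P -> B \subset D) ->
    (forall x, x \in D -> exists2 B, B \in P & x \in B) ->
    (forall B C x, B \in P -> C \in P -> x \in B -> x \in C -> B = C) ->
  partition P D.
Proof.
move=> n0 sub cov tI; apply/and3P; split.
- rewrite eqEsubset; apply/andP; split; first by apply/bigcupsP.
  by apply/subsetP => x /cov[B BP xB]; apply/bigcupP; exists B.
- apply/trivIsetP => B C BP CP BC; rewrite -setI_eq0.
  by apply: contraNT BC => /set0Pn[x /setIP[xB xC]]; apply/eqP/(tI _ _ x).
- by apply/negP => /n0; rewrite eqxx.
Qed.

Lemma partitionU P Q D E : partition P D -> partition Q E -> [disjoint D & E] ->
  partition (P :|: Q) (D :|: E).
Proof.
move=> pP qQ dDE; apply/and3P; split.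
- by rewrite /cover bigcup_setU -!/(cover _) (cover_partition pP) (cover_partition qQ).
- apply: trivIsetU; [exact: partition_trivIset pP|exact: partition_trivIset qQ|].
  by rewrite (cover_partition pP) (cover_partition qQ).
- by rewrite inE (partition0 pP) (partition0 qQ).
Qed.

Lemma partition_sub P D E : partition P D -> E \subset D ->
    (forall B x, B \in P -> x \in B -> x \in E -> B \subset E) ->
  partition (P ::&: E) E.
Proof.
move=> pP ED sat; apply: partitionI.
- by move=> B /setIdP[/(partition_neq0 pP)].
- by move=> B /setIdP[].
- move=> x xE; have [B BP xB] := partition_cover pP (subsetP ED x xE).
  by exists B => //; rewrite inE BP (sat B x).
- by move=> B C x /setIdP[BP _] /setIdP[CP _]; apply: partition_eq_block pP BP CP.
Qed.

End Partitions.

Section NoncrossingSums.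
Variable N : nat.
Notation T := 'I_N.
Implicit Types (p q : {set {set T}}) (B C D E : {set T}) (a c x : T).

Lemma noncrossingP p : reflect
  (forall B C x y z t, B \in p -> C \in p -> x \in B -> y \in C -> z \in B -> t \in C ->
     (x < y)%N -> (y < z)%N -> (z < t)%N -> B = C)
  (noncrossing p).
Proof.
apply: (iffP idP) => [nc B C x y z t Bp Cp xB yC zB tC xy yz zt|nc].
  move/'forall_in_forall_inP/(_ B Bp C Cp)/implyP: nc => nc.
  apply/eqP; apply: contraT => /nc/negP[].
  apply/'exists_in_exists_inP; exists x => //; exists y => //.
  by apply/'exists_in_exists_inP; exists z => //; exists t => //; apply/and3P.
apply/'forall_in_forall_inP => B Bp C Cp; apply/implyP => BC.
apply/negP => /'exists_in_exists_inP[x xB [y yC]].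
move=> /'exists_in_exists_inP[z zB [t tC /and3P[xy yz zt]]].
by case/eqP: BC; apply: (nc _ _ x y z t).
Qed.

Lemma noncrossing_sub p q : noncrossing p ->
    (forall B, B \in q -> exists2 D, D \in p & B \subset D) ->
    (forall B C D, B \in q -> C \in q -> D \in p -> B \subset D -> C \subset D -> B = C) ->
  noncrossing q.
Proof.
move=> /noncrossingP nc sub inj; apply/noncrossingP => B C x y z t Bq Cq xB yC zB tC *.
have [B' Bp sB] := sub B Bq; have [C' Cp sC] := sub C Cq.
apply: (inj B C B') => //; suff -> : B' = C' by [].
by apply: (nc _ _ x y z t) => //; (exact: (subsetP sB) || exact: (subsetP sC)).
Qed.

Lemma noncrossing_subset p q : noncrossing p -> q \subset p -> noncrossing q.
Proof.
move=> /noncrossingP nc /subsetP qp; apply/noncrossingP => B C x y z t /qp Bp /qp Cp.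
exact: nc.
Qed.

Definition ncp B p := partition p B && noncrossing p.

Variable A : comNzRingType.
Implicit Types (f g : nat -> A).
Variable g : nat -> A.

Definition ncsum B : A := \sum_(p | ncp B p) \prod_(C in p) g #|C|.
(* The block of [a] is weighted by [f], all others by [g]. *)
Definition ncsum_first a B f : A :=
  \sum_(p | ncp (a |: B) p) f #|pblock p a| * \prod_(C in p | a \notin C) g #|C|.

Lemma ncsum_firstE a B : ncsum (a |: B) = ncsum_first a B g.
Proof.
apply: eq_bigr => p /andP[pp _].
have aB : a \in a |: B by rewrite setU11.
have pa : pblock p a \in p by rewrite pblock_mem // (cover_partition pp).
rewrite (bigD1 (pblock p a)) //=; congr (_ * _); apply: eq_bigl => C.
have [Cp /=|//] := boolP (C \in p); congr (~~ _); apply/eqP/idP.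
  by move->; rewrite mem_pblock (cover_partition pp).
by move=> aC; rewrite (def_pblock (partition_trivIset pp) Cp aC).
Qed.

Lemma ncsum0 : ncsum set0 = 1.
Proof.
rewrite /ncsum (big_pred1 set0) ?big_set0 // => p.
rewrite /ncp partition_set0 /=; have [->|//] := eqVneq p set0.
by apply/noncrossingP => B C x y z t; rewrite in_set0.
Qed.

Section Recursion.
Variables (a : T) (B : {set T}).
Hypothesis aB : forall x, x \in B -> (a < x)%N.

Let aNB : a \notin B.
Proof. by apply/negP => /aB; rewrite ltnn. Qed.

Lemma ncsum_singleton f :
  \sum_(p | ncp (a |: B) p && (pblock p a == [set a]))
     f #|pblock p a| * \prod_(C in p | a \notin C) g #|C| = f 1%N * ncsum B.
Proof.
rewrite (reindex_onto (fun p => [set a] |: p) (fun p => p :\ [set a])) /=; last first.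
  move=> p /andP[/andP[pp _] /eqP E]; rewrite setD1K // -E pblock_mem //.
  by rewrite (cover_partition pp) setU11.
rewrite /ncsum big_distrr /=; apply: congr_big => //.
  move=> p; apply/andP/idP => [[/andP[/andP[pp nc] /eqP E] /eqP pE]|/andP[pp nc]].
    rewrite -pE; apply/andP; split.
      rewrite -(setU1K aNB); apply: partitionD1 => //; exact: setU11.
    by apply: noncrossing_subset nc _; rewrite subsetDl.
  have dis : [disjoint [set a] & B] by rewrite disjoints1.
  have pp' : partition ([set a] |: p) (a |: B).
    by apply: partitionU1 => //; apply/set0Pn; exists a; rewrite set11.
  have aNp : [set a] \notin p.
    apply: contraNN aNB => ap; apply: (partition_mem pp ap); exact: set11.
  rewrite setU1K // eqxx /ncp pp' /=; split=> //; apply/andP; split; last first.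
    by rewrite (def_pblock (partition_trivIset pp') (setU11 _ _) (set11 a)).
  apply/noncrossingP => D E x y z t.
  case/setU1P=> [->|Dp] /setU1P[->|Ep] //.
  - by move=> /set1P-> _ /set1P-> _ /ltn_trans h /h; rewrite ltnn.
  - by move=> _ /set1P-> _ /set1P-> _ /ltn_trans h /h; rewrite ltnn.
  - exact: (noncrossingP _ nc).
move=> p /andP[/andP[/andP[pp _] /eqP ->] /eqP pE].
rewrite cards1; congr (_ * _); apply: eq_bigl => C; rewrite in_setU1.
have [->|/= CNa] := eqVneq C [set a].
  rewrite set11 /=; apply/esym/negbTE; rewrite -pE in_setD1 eqxx //.
have [Cp|//] := boolP (C \in p).
have := partition_mem pp (setU1r _ Cp).
have tI := partition_eq_block pp (setU11 _ _) (setU1r _ Cp) (set11 a).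
by move=> _; apply/negP => /tI /esym/eqP; rewrite (negbTE CNa).
Qed.

(** Let [c] be the second element of the block of [a]. Every other block lies entirely in [J c],
    between [a] and [c], or entirely in [K c], beyond [c]. *)
Let J c : {set T} := [set x in B | (x < c)%N].
Let K c : {set T} := [set x in B | (c < x)%N].

Definition second_in_block p c :=
  (c \in pblock p a) && [forall x in pblock p a, (x != a) ==> (c <= x)%N].

(** The two maps are inverse to each other: [glue] adds [a] to the block of [c], and [unglue]
    removes [a] and separates the blocks before [c] from the rest. *)
Definition glue c (pq : {set {set T}} * {set {set T}}) : {set {set T}} :=
  pq.1 :|: ((a |: pblock pq.2 c) |: (pq.2 :\ pblock pq.2 c)).
Definition unglue c p : {set {set T}} * {set {set T}} :=
  (p ::&: J c, (pblock p a :\ a) |: ((p :\ pblock p a) ::&: (c |: K c))).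

(** A block other than that of [a] with a point [x] in [J c] and a point [y] beyond [c] would give
    the crossing [a < x < c < y]. Hence [J c] and [c |: K c] are unions of blocks once [a] is
    removed. *)
Lemma unglueP c p : c \in B -> ncp (a |: B) p -> second_in_block p c ->
  [/\ ncp (J c) (unglue c p).1, ncp (c |: K c) (unglue c p).2
    & glue c (unglue c p) = p].
Proof.
move=> cB /andP[pp nc] /andP[cX /'forall_in_implyP minc].
have ac := aB cB.
set X := pblock p a in cX minc *.
have aX : a \in X by rewrite mem_pblock (cover_partition pp) setU11.
have Xp : X \in p by rewrite pblock_mem // -mem_pblock.
have tI := partition_eq_block pp.
have sat D x : D \in p -> D != X -> x \in D -> x \in J c -> D \subset J c.
  move=> Dp DX xD /setIdP[xB xc]; apply/subsetP => y yD.
  have := partition_mem pp Dp yD; case/setU1P => [ya|yB].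
    by move: DX; rewrite (tI D X a) ?eqxx // -ya.
  rewrite inE yB /= ltnNge; apply/negP; rewrite leq_eqVlt => /orP[/eqP/val_inj E|cy].
    by move: DX; rewrite (tI D X c) ?eqxx // E.
  move: DX; rewrite -(noncrossingP _ nc X D a x c y) ?eqxx //; exact: aB.
have sat' D x : D \in p -> D != X -> x \in D -> x \in c |: K c -> D \subset c |: K c.
  move=> Dp DX xD xK; apply/subsetP => y yD.
  have := partition_mem pp Dp yD; case/setU1P => [ya|yB].
    by move: DX; rewrite (tI D X a) ?eqxx // -ya.
  rewrite !inE yB /=; case: (ltngtP y c) => [yc|_|/val_inj ->]; rewrite ?orbT ?eqxx //.
  have yJ : y \in J c by rewrite inE yB.
  have /subsetP/(_ x xD) := sat D y Dp DX yD yJ.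
  rewrite inE => /andP[_ xc]; case/setU1P: xK => [xE|/setIdP[_ cx]].
    by rewrite xE ltnn in xc.
  by have := ltn_trans xc cx; rewrite ltnn.
have XK : X :\ a \subset c |: K c.
  apply/subsetP => x /setD1P[xa xX]; have := partition_mem pp Xp xX.
  rewrite !inE (negbTE xa) /= => ->; rewrite /= eq_sym.
  by have := minc x xX xa; rewrite leq_eqVlt.
have pD := partitionD1 pp Xp.
have p2 : partition ((X :\ a) |: ((p :\ X) ::&: (c |: K c))) (c |: K c).
  have E : c |: K c = (X :\ a) :|: ((c |: K c) :\: X).
    apply/setP => x; rewrite [RHS]in_setU in_setD; have [xX|xX] := boolP (x \in X).
      rewrite in_setD1 xX andbT orbF; have [->|xa] := eqVneq x a.
        rewrite !inE (negbTE aNB) /= orbF; apply/negbTE.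
        by apply: contraTneq ac => ->; rewrite ltnn.
      by apply: (subsetP XK); rewrite in_setD1 xa.
    by rewrite in_setD1 (negbTE xX) andbF.
  rewrite {2}E.
  have E2 : (p :\ X) ::&: (c |: K c) = (p :\ X) ::&: ((c |: K c) :\: X).
    apply/setP => D; rewrite !inE; case: eqP => //= DX.
    have [Dp|//] /= := boolP (D \in p); rewrite subsetD.
    by rewrite (trivIsetP (partition_trivIset pp)) ?andbT //; apply/eqP.
  rewrite E2; apply: partitionU1; last 2 first.
  - by apply/set0Pn; exists c; rewrite in_setD1 cX andbT; apply: contraTneq ac => ->;
    rewrite ltnn.
  - by rewrite -setI_eq0; apply/eqP/setP => x; rewrite !inE; case: (x \in X);
    rewrite ?andbF.
  apply: (partition_sub pD).
    apply: setSD; apply/subsetP => x; rewrite !inE => /orP[/eqP->|/andP[-> _]];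
      by rewrite ?cB orbT.
  move=> D x /setD1P[DX Dp] xD /setDP[xK _]; rewrite subsetD (sat' D x) //.
  by rewrite (trivIsetP (partition_trivIset pp)).
split.
- apply/andP; split; last by apply: noncrossing_subset nc _; apply/subsetP => D /setIdP[].
  apply: (partition_sub pp); first by apply/subsetP => x /setIdP[xB _]; rewrite setU1r.
  move=> D x Dp xD xJ; apply: (sat D x) => //; apply/eqP => DX; move: xD; rewrite DX => xX.
  case/setIdP: xJ => xB; rewrite ltnNge minc //.
  by apply: contraNneq aNB => <-.
- apply/andP; split=> //; apply: noncrossing_sub nc _ _.
    move=> D /setU1P[->|/setIdP[/setD1P[_ Dp] _]]; last by exists D.
    by exists X => //; rewrite subD1set.
  move=> D E F Dp Ep Fp DF EF.
  have /set0Pn[x xD] := partition_neq0 p2 Dp.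
  have /set0Pn[y yE] := partition_neq0 p2 Ep.
  have FX G z : G \in (p :\ X) ::&: (c |: K c) -> G \subset F -> z \in G -> F = G.
    move=> /setIdP[/setD1P[_ Gp] _] GF zG.
    by apply: (tI _ _ z) => //; apply: (subsetP GF).
  have FX' z : X :\ a \subset F -> z \in X :\ a -> F = X.
    move=> GF zG; apply: (tI _ _ z) => //; first exact: (subsetP GF).
    by case/setD1P: zG.
  case/setU1P: Dp DF xD => [->|Dp] DF xD; case/setU1P: Ep EF yE => [->|Ep] EF yE //.
  + have := FX' _ DF xD; rewrite (FX _ _ Ep EF yE) => E0.
    by case/setIdP: Ep => /setD1P[/eqP].
  + have := FX' _ EF yE; rewrite (FX _ _ Dp DF xD) => E0.
    by case/setIdP: Dp => /setD1P[/eqP].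
  + by rewrite -(FX _ _ Dp DF xD) (FX _ _ Ep EF yE).
have cXa : c \in X :\ a by rewrite in_setD1 cX andbT; apply: contraTneq ac => ->;
  rewrite ltnn.
rewrite /glue /=.
rewrite (def_pblock (partition_trivIset p2) (setU11 _ _) cXa) setD1K // setU1K; last first.
  apply/negP => /setIdP[/setD1P[/eqP XX Xap] _]; apply: XX.
  by apply: (tI _ _ c).
apply/setP => D; rewrite !inE; have [->|DX] /= := eqVneq D X.
  by rewrite Xp orbT.
have [Dp|//] := boolP (D \in p) => /=.
have /set0Pn[x xD] := partition_neq0 pp Dp.
have := partition_mem pp Dp xD; case/setU1P => [xa|xB].
  by move: DX; rewrite (tI D X a) ?eqxx // -xa.
case: (ltnP x c) => [xc|cx].
  by rewrite (sat D x) // inE xB.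
rewrite (sat' D x) ?orbT // !inE xB /= eq_sym.
by move: cx; rewrite leq_eqVlt.
Qed.

Lemma glueP c p q : c \in B -> ncp (J c) p -> ncp (c |: K c) q ->
  [/\ ncp (a |: B) (glue c (p, q)), second_in_block (glue c (p, q)) c,
      #|pblock (glue c (p, q)) a| = #|pblock q c|.+1,
      unglue c (glue c (p, q)) = (p, q)
    & \prod_(C in glue c (p, q) | a \notin C) g #|C| =
      (\prod_(C in p) g #|C|) * \prod_(C in q | c \notin C) g #|C|].
Proof.
move=> cB /andP[pp ncpp] /andP[qq ncq].
have ac := aB cB.
set E := pblock q c.
have cE : c \in E by rewrite mem_pblock (cover_partition qq) setU11.
have Eq : E \in q by rewrite pblock_mem // -mem_pblock.
have tIq := partition_eq_block qq.
have aK : a \notin c |: K c.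
  rewrite !inE (negbTE aNB) orbF; by apply: contraTneq ac => ->; rewrite ltnn.
have aJ : a \notin J c by rewrite inE (negbTE aNB).
have aE : a \notin E by apply: contra aK => /(partition_mem qq Eq).
have geK x : x \in c |: K c -> (c <= x)%N.
  by rewrite !inE => /orP[/eqP->|/andP[_ /ltnW]].
have dJK : [disjoint J c & a |: (c |: K c)].
  rewrite -setI_eq0; apply/eqP/setP => x; rewrite in_setI in_setU1 in_set0.
  apply/negP => /andP[xJ /orP[/eqP xa|/geK]]; first by rewrite -xa xJ in aJ.
  by case/setIdP: xJ; rewrite ltnNge => _ /negbTE->.
have q2 : partition ((a |: E) |: (q :\ E)) (a |: (c |: K c)).
  have -> : a |: (c |: K c) = (a |: E) :|: ((c |: K c) :\: E).
    by rewrite -setUA; congr (_ :|: _); rewrite setDE setUIr setUCr setIT;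
      apply/esym/setUidPr; apply: (partitionS qq).
  apply: partitionU1; first exact: partitionD1.
    by apply/set0Pn; exists a; rewrite setU11.
  rewrite -setI_eq0; apply/eqP/setP => x; rewrite !(in_setI, in_setD, in_setU1 x a) in_set0.
  have [->|_] := eqVneq x a; first by rewrite (negbTE aK) !andbF.
  by case: (x \in E); rewrite ?andbF.
have pg : partition (glue c (p, q)) (a |: B).
  have -> : a |: B = J c :|: (a |: (c |: K c)).
    apply/setP => x; rewrite !inE; case: (x == a) => /=; first by rewrite orbT.
    have [->|xc] := eqVneq x c; first by rewrite cB orbT.
    by rewrite -andb_orr -neq_ltn (inj_eq val_inj) xc andbT.
  exact: partitionU.
have aEg : a |: E \in glue c (p, q) by rewrite inE setU11 orbT.
have pb : pblock (glue c (p, q)) a = a |: E.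
  by rewrite (def_pblock (partition_trivIset pg) aEg) // setU11.
have qK D x : D \in q -> x \in D -> (c <= x)%N.
  by move=> Dq /(partition_mem qq Dq)/geK.
have q2K D x : D \in (a |: E) |: (q :\ E) -> x \in D -> x != a -> (c <= x)%N.
  move=> /setU1P[-> /setU1P[->|xE]|/setD1P[_ Dq] xD _]; rewrite ?eqxx //.
    by move=> _; apply: qK xE.
  exact: qK xD.
have q2a D x : D \in (a |: E) |: (q :\ E) -> x \in D -> (a <= x)%N.
  move=> Dq xD; have [->//|xa] := eqVneq x a.
  exact: leq_trans (ltnW ac) (q2K _ _ Dq xD xa).
have pJ D x : D \in p -> x \in D -> (x < c)%N.
  by move=> Dp /(partition_mem pp Dp)/setIdP[].
have pa D x : D \in p -> x \in D -> (a < x)%N.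
  by move=> Dp /(partition_mem pp Dp)/setIdP[/aB].
(* Blocks of [p] live strictly between [a] and [c], while all other points are [a] or at least [c],
   so a block of the first kind crosses none of the second. A crossing among the latter can use [a]
   only as its smallest point. *)
have ncg : noncrossing (glue c (p, q)).
  apply/noncrossingP => D F x y z t; rewrite /glue /= -/E => /setUP[Dp|Dq] /setUP[Fp|Fq].
  - exact: (noncrossingP _ ncpp).
  - move=> xD yF zD tF xy yz zt.
    have ya : y != a by apply: contraTneq xy => ->; rewrite -leqNgt ltnW // (pa D).
    have := leq_ltn_trans (q2K _ _ Fq yF ya) (ltn_trans yz (pJ _ _ Dp zD)).
    by rewrite ltnn.
  - move=> xD yF zD tF xy yz zt.
    have za : z != a.
      by apply: contraTneq (ltn_trans (pa _ _ Fp yF) yz) => ->; rewrite ltnn.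
    have := leq_ltn_trans (q2K _ _ Dq zD za) (ltn_trans zt (pJ _ _ Fp tF)).
    by rewrite ltnn.
  move=> xD yF zD tF xy yz zt.
  have ya : y != a by apply: contraTneq xy => ->; rewrite -leqNgt (q2a D).
  have za : z != a by apply: contraTneq (ltn_trans xy yz) => ->; rewrite -leqNgt (q2a D).
  have ta : t != a.
    by apply: contraTneq (ltn_trans xy (ltn_trans yz zt)) => ->; rewrite -leqNgt (q2a D).
  case/setU1P: Dq xD zD => [->|/setD1P[DE Dq]];
    case/setU1P: Fq yF tF => [->|/setD1P[FE Fq]] //.
  + move=> yF tF xD /setU1P[/eqP|zE]; rewrite ?(negbTE za) //.
    (* The point [x] may be [a], which is not in [E]; replacing it by [c] gives a crossing inside
       [q]. *)
    have cy : (c < y)%N.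
      rewrite ltn_neqAle (qK F) // andbT; apply: contraNneq FE => /val_inj cy.
      by rewrite (tIq F E c) // cy.
    by move: FE; rewrite -(noncrossingP _ ncq E F c y z t) ?eqxx.
  + move=> /setU1P[/eqP|yE]; rewrite ?(negbTE ya) //.
    move=> /setU1P[/eqP|tE]; rewrite ?(negbTE ta) // => xD zD.
    by move: DE; rewrite -(noncrossingP _ ncq D E x y z t) ?eqxx.
  + by move=> yF tF xD zD; apply: (noncrossingP _ ncq D F x y z t).
have nE D : D \in q -> D != E -> c \notin D.
  by move=> Dq DE; apply: contraNN DE => cD; rewrite (tIq D E c).
split.
- by rewrite /ncp pg.
- rewrite /second_in_block pb in_setU1 cE orbT; apply/'forall_in_implyP => x.
  by move=> /setU1P[->|xE _]; rewrite ?eqxx // (qK E).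
- by rewrite pb cardsU1 aE.
- rewrite /unglue pb; congr (_, _).
    apply/setP => D; rewrite !inE -/E; have [Dp|Dp] /= := boolP (D \in p).
      by apply/subsetP => x /(partition_mem pp Dp).
    have [->|/= DaE] := eqVneq D (a |: E).
      by apply/negbTE/subsetPn; exists a; rewrite ?setU11.
    apply/negP => /andP[/andP[_ Dq] DJ].
    have /set0Pn[x xD] := partition_neq0 qq Dq.
    have /setIdP[_] := subsetP DJ x xD; rewrite ltnNge => /negP; apply.
    exact: qK xD.
  rewrite setU1K //.
  have -> : (glue c (p, q) :\ (a |: E)) ::&: (c |: K c) = q :\ E.
    apply/setP => D; rewrite !inE -/E; have [->|/= DaE] := eqVneq D (a |: E).
      by apply/esym/negP => /andP[_ Dq]; move/negP: aK; apply;
        apply: (partition_mem qq Dq); rewrite setU11.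
    have [Dp|Dp] /= := boolP (D \in p).
      have /set0Pn[x xD] := partition_neq0 pp Dp.
      transitivity false.
        apply/negP => /subsetP/(_ x xD)/geK.
        by rewrite leqNgt (pJ D).
      apply/esym/negP => /andP[_ Dq].
      by have := qK _ _ Dq xD; rewrite leqNgt (pJ D).
    have [->|DE] /= := eqVneq D E; first by [].
    by have [Dq|//] := boolP (D \in q); apply: (partitionS qq).
  by rewrite setD1K.
have dpq : [disjoint p & q :\ E].
  rewrite -setI_eq0; apply/eqP/setP => D; rewrite in_set0;
    apply/negP => /setIP[Dp /setD1P[_ Dq]].
  have /set0Pn[x xD] := partition_neq0 pp Dp.
  by have := qK _ _ Dq xD; rewrite leqNgt (pJ D).
transitivity (\prod_(C in [predU p & q :\ E]) g #|C|).
  apply: eq_bigl => C; rewrite /glue /= -/E !inE.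
  have [Cp|Cp] /= := boolP (C \in p).
    by apply/negP => /(pa _ _ Cp); rewrite ltnn.
  have [->|/= CaE] := eqVneq C (a |: E).
    rewrite setU11; apply/esym/negP => /andP[_ Cq]; case/negP: aK.
    by apply: (partition_mem qq Cq); rewrite setU11.
  have [Cq|] := boolP (C \in q); rewrite ?andbF //.
  by rewrite [a \in C](contraNF _ aK) ?andbT // => /(partition_mem qq Cq).
rewrite bigU //; congr (_ * _); apply: eq_bigl => C; rewrite in_setD1.
have [Cq|] := boolP (C \in q); rewrite ?andbF // andbT /=.
have [->|/= CE] := eqVneq C E; first by rewrite cE.
by rewrite nE.
Qed.

Lemma ncsum_glue c f : c \in B ->
  \sum_(p | ncp (a |: B) p && second_in_block p c)
     f #|pblock p a| * \prod_(C in p | a \notin C) g #|C|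
  = ncsum (J c) * ncsum_first c (K c) (fun i => f i.+1).
Proof.
move=> cB; rewrite /ncsum /ncsum_first big_distrlr pair_big /=.
rewrite (reindex_onto (glue c) (unglue c)) /=; last first.
  by move=> p /andP[pp sp]; have [] := unglueP cB pp sp.
apply: congr_big => //.
  move=> [p q]; apply/andP/andP => /= [[/andP[gg sg] /eqP E]|[pp qq]].
    by have [] := unglueP cB gg sg; rewrite E.
  by have [-> -> _ -> _] := glueP cB pp qq; rewrite eqxx.
move=> [p q] /andP[/andP[gg sg] /eqP E] /=.
have [] := unglueP cB gg sg; rewrite E => pp qq _.
have [_ _ -> _ ->] := glueP cB pp qq; ring.
Qed.

(** Either [a] is a singleton, or the partition is cut at the second element [c] of its block. The
    block of [a] loses one element in the cut, whence the shift of [f]. *)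
Lemma ncsum_first_rec f :
  ncsum_first a B f = f 1%N * ncsum B +
    \sum_(c in B) ncsum (J c) * ncsum_first c (K c) (fun i => f i.+1).
Proof.
rewrite /ncsum_first (bigID (fun p => pblock p a == [set a])) /=.
rewrite ncsum_singleton; congr (_ + _).
have ex p : ncp (a |: B) p -> pblock p a != [set a] ->
    exists2 c, c \in B & second_in_block p c.
  move=> /andP[pp _] X1.
  have cov : a \in cover p by rewrite (cover_partition pp) setU11.
  have aX : a \in pblock p a by rewrite mem_pblock.
  have Xp := pblock_mem cov.
  have [x xX xa] : exists2 x, x \in pblock p a & x != a.
    apply/exists_inP; apply: contraR X1; rewrite negb_exists_in => /forall_inP h.
    rewrite eqEsubset sub1set aX andbT; apply/subsetP => y /h; rewrite negbK => /eqP->.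
    exact: set11.
  case: (@arg_minnP _ x (fun x => (x \in pblock p a) && (x != a)) val).
    by rewrite xX.
  move=> c /andP[cX ca] cmin; exists c.
    by have := partition_mem pp Xp cX; rewrite in_setU1 (negbTE ca).
  rewrite /second_in_block cX; apply/'forall_in_implyP => y yX ya.
  by apply: cmin; rewrite yX.
have uniq p c c' : c \in B -> c' \in B -> second_in_block p c -> second_in_block p c' ->
  c = c'.
  move=> cB c'B /andP[cX /'forall_in_implyP h] /andP[c'X /'forall_in_implyP h'].
  apply/val_inj/anti_leq; rewrite h ?h' //.
    by apply: contraNneq aNB => <-.
  by apply: contraNneq aNB => <-.
(* On the partitions summed here the block of [a] has a second element, so the default [a] is never
   taken. *)
pose key p := odflt a [pick c | (c \in B) && second_in_block p c].
have keyP p c : c \in B -> ncp (a |: B) p -> pblock p a != [set a] ->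
    (key p == c) = second_in_block p c.
  move=> cB pp X1; rewrite /key; case: pickP => [c' /andP[c'B sc']|no] /=.
    apply/eqP/idP => [<- //|sc]; exact: uniq sc.
  have [c' c'B sc'] := ex p pp X1.
  by have := no c'; rewrite c'B sc'.
rewrite (partition_big key (mem B)) /=; last first.
  move=> p /andP[pp X1]; have [c cB sc] := ex p pp X1.
  by have := keyP p c cB pp X1; rewrite sc => /eqP->.
apply: eq_bigr => c cB; rewrite -ncsum_glue //; apply: eq_bigl => p.
have [pp|//] /= := boolP (ncp (a |: B) p).
have [X1|X1] /= := eqVneq (pblock p a) [set a]; last by rewrite keyP.
apply/esym/negbTE; rewrite /second_in_block X1 negb_and in_set1.
by apply/orP; left; apply: contraNneq aNB => <-.
Qed.

End Recursion.

(** Induction by removing the largest element, whose rank is [#|B| - 1]; the ranks of the other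
    elements do not change. *)
Lemma sum_rank B (F : nat -> A) :
  \sum_(c in B) F #|[set x in B | (x < c)%N]| = \sum_(i < #|B|) F i.
Proof.
move: {2}#|B| (erefl #|B|) => m; elim: m B => [|m IH] B Bm.
  by rewrite Bm big_ord0 (cards0_eq Bm) big_set0.
have /set0Pn[x0 x0B] : B != set0 by rewrite -card_gt0 Bm.
case: (@arg_maxnP _ x0 (fun x => x \in B) val x0B) => M MB Mmax.
have BM : #|B :\ M| = m by have := cardsD1 M B; rewrite MB Bm => -[].
have lt x : x \in B :\ M -> (x < M)%N.
  by move=> /setD1P[xM xB]; rewrite ltn_neqAle (inj_eq val_inj) xM; apply: Mmax.
rewrite (big_setD1 M) //= Bm big_ord_recr /= addrC; congr (_ + F _).
  rewrite -BM -IH //; apply: eq_bigr => c cB; congr (F #|pred_of_set _|).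
  apply/setP => x; rewrite !inE; have [->|//] := eqVneq x M.
  by rewrite MB /= ltnNge ltnW // lt.
rewrite -BM; apply: eq_card => x; rewrite !inE.
have [->|xM] := eqVneq x M; first by rewrite ltnn andbF.
by have [xB|//] /= := boolP (x \in B); apply: lt; rewrite !inE xM.
Qed.

End NoncrossingSums.

(** * Noncrossing sums as coefficients of a Lagrange series *)

Section NoncrossingLagrange.
Variables (N : nat) (A : comNzRingType) (gamma : {poly A}).
Hypothesis gamma0 : gamma`_0 = 1.
Implicit Types (a : 'I_N) (B : {set 'I_N}) (f : nat -> A).
Notation g := (fun i => gamma`_i).

(** Let [y = u gamma(y)]. The cut at the second element splits off one factor [y] and shifts [f], so
    it matches [y^(s+1) = y y^s] ([lagr_conv]). For [f = g] the sum over [s] is the expansion of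
    [u gamma(y)], which advances the first claim by one element; hence the joint induction. *)
Lemma ncsum_lagr_both m :
  (forall B, #|B| = m -> ncsum g B = lagr gamma m.+1 1) /\
  (forall a B f, (forall x, x \in B -> (a < x)%N) -> #|B| = m ->
     ncsum_first g a B f = \sum_(s < m.+2) f s * lagr gamma m.+1 s).
Proof.
elim/ltn_ind: m => m IH.
have S B : #|B| = m -> ncsum g B = lagr gamma m.+1 1.
  case: m IH => [|m] IH Bm.
    by rewrite (cards0_eq Bm) ncsum0 (@lagrSS _ _ _ _ 1) // big_ord_recl big_ord0 gamma0
      lagr0 /= mulr1 addr0.
  have /set0Pn[x0 x0B] : B != set0 by rewrite -card_gt0 Bm.
  case: (@arg_minnP _ x0 (fun x => x \in B) val x0B) => a aB amin.
  have Bm' : #|B :\ a| = m by have := cardsD1 a B; rewrite aB Bm => -[].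
  rewrite -(setD1K aB) ncsum_firstE (IH m (ltnSn m)).2 //.
  by move=> x /setD1P[xa xB]; rewrite ltn_neqAle (inj_eq val_inj) eq_sym xa; apply: amin.
split; first exact: S.
move=> a B f aB Bm.
rewrite ncsum_first_rec // S //.
pose F i := lagr gamma i.+1 1 * \sum_(s < (m - i).+1) f s.+1 * lagr gamma (m - i) s.
transitivity (f 1%N * lagr gamma m.+1 1 + \sum_(i < m) F i).
  congr (_ + _); rewrite -Bm -(sum_rank B F); apply: eq_bigr => c cB.
  have JK : (#|[set x in B | (x < c)%N]| + #|[set x in B | (c < x)%N]|).+1 = m.
    rewrite -Bm (cardsD1 c B) cB -cardsUI addnC.
    have -> : [set x in B | (x < c)%N] :&: [set x in B | (c < x)%N] = set0.
      apply/setP => x; rewrite !inE; case: ltngtP; rewrite ?andbF //.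
    rewrite cards0 add0n; congr _.+1; apply: eq_card => x; rewrite !inE.
    by rewrite -andb_orr -neq_ltn (inj_eq val_inj) andbC.
  rewrite /F; have [|-> // _] := IH #|[set x in B | (x < c)%N]|;
    first by rewrite -JK ltnS leq_addr.
  have [|_ ->] := IH #|[set x in B | (c < x)%N]|; first by rewrite -JK ltnS leq_addl.
  - by rewrite -JK -addnS addKn.
  - by move=> x /setIdP[].
  - by [].
rewrite big_ord_recl lagrS0 mulr0 add0r.
transitivity (\sum_(s < m.+1) f s.+1 * \sum_(i < m.+2) lagr gamma i 1 * lagr gamma (m.+1
  - i) s); last first.
  by apply: eq_bigr => s _; rewrite lagr_conv.
transitivity (\sum_(i < m.+1) lagr gamma i.+1 1 * \sum_(s < m.+1) f s.+1 * lagr gamma (m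
  - i) s).
  rewrite big_ord_recr [LHS]addrC /=; congr (_ + _).
    apply: eq_bigr => i _; rewrite /F; congr (_ * _).
    rewrite (big_ord_widen m.+1 (fun s =>
      f s.+1 * lagr gamma (m - i) s)) ?ltnS ?leq_subr //.
    rewrite [RHS](bigID (fun s : 'I_m.+1 => (s < (m - i).+1)%N)) /=.
    rewrite [X in _ + X]big1 ?addr0 // => s; rewrite -leqNgt => ms.
    by rewrite lagr_gt ?mulr0.
  rewrite subnn big_ord_recl big1 ?addr0 /= ?lagr0; last by move=> i _; rewrite lagr0 mulr0.
  by rewrite mulr1 mulrC.
under [RHS]eq_bigr => s _ do rewrite big_ord_recl mul0r add0r big_distrr.
rewrite exchange_big; apply: eq_bigr => i _ /=; rewrite big_distrr.
by apply: eq_bigr => s _ /=; rewrite mulrCA.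
Qed.

Lemma ncsum_lagr B : ncsum g B = lagr gamma #|B|.+1 1.
Proof. by have [-> ] := ncsum_lagr_both #|B|. Qed.

End NoncrossingLagrange.

(** * The lattice of noncrossing partitions *)

Section NoncrossingLattice.
Variable N : nat.
Implicit Types (u v w : NC N) (B C D E : {set 'I_N}).

Lemma blocks_nc v : noncrossing (blocks v).
Proof. by case: v => p /= /andP[]. Qed.

Lemma nc_leP v w : reflect (forall C, C \in blocks v -> exists2 B, B \in blocks w & C
  \subset B) (v <= w)%O.
Proof. exact: refinesP. Qed.

Lemma nc_le_block v w B C x : (v <= w)%O -> B \in blocks w -> C \in blocks v ->
  x \in C -> x \in B -> C \subset B.
Proof.
move=> /nc_leP vw Bw Cv xC xB; have [D Dw CD] := vw C Cv.
by rewrite (partition_eq_block (blocks_partition w) Bw Dw xB) // (subsetP CD).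
Qed.

Lemma nc_restrict v w B : (v <= w)%O -> B \in blocks w -> ncp B (blocks v ::&: B).
Proof.
move=> vw Bw; apply/andP; split.
  apply: (partition_sub (blocks_partition v)); first exact: subsetT.
  by move=> C x Cv xC xB; apply: nc_le_block vw Bw Cv xC xB.
by apply: noncrossing_subset (blocks_nc v) _; apply/subsetP => D /setIdP[].
Qed.

Section BigBlocks.
Variables (R : Type) (idx : R) (op : Monoid.com_law idx).
Lemma big_blocks v w (F : {set 'I_N} -> R) : (v <= w)%O ->
  \big[op/idx]_(C in blocks v) F C =
  \big[op/idx]_(B in blocks w) \big[op/idx]_(C in blocks v ::&: B) F C.
Proof.
move=> vw; pose key C := odflt set0 [pick B in blocks w | C \subset B].
rewrite (partition_big key (mem (blocks w))) /=; last first.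
  move=> C /(nc_leP v w vw)[B Bw CB]; rewrite /key.
  by case: pickP => [D /andP[]//|/(_ B)]; rewrite Bw CB.
apply: eq_bigr => B Bw; apply: eq_bigl => C; rewrite inE.
have [Cv|//] /= := boolP (C \in blocks v).
rewrite /key; case: pickP => [D /andP[Dw CD]|no] /=; last first.
  have [D Dw CD] := nc_leP v w vw C Cv.
  by have := no D; rewrite Dw CD.
apply/eqP/idP => [<- //|CB].
have /set0Pn[x xC] := partition_neq0 (blocks_partition v) Cv.
by apply: (partition_eq_block (blocks_partition w) Dw Bw (x := x)); exact: (subsetP _ x xC).
Qed.
End BigBlocks.

(** The partitions below [w] are the independent choices of a noncrossing partition of each block of
    [w], so the sum factors. Pieces of different blocks of [w] do not cross because [w] is
    noncrossing. *)
Lemma nc_interval_sum (A : comNzRingType) (g : nat -> A) w :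
  \sum_(v | (v <= w)%O) \prod_(C in blocks v) g #|C| = \prod_(B in blocks w) ncsum g B.
Proof.
rewrite /ncsum (big_distr_big_dep set0) /=.
(* [h] collects the pieces and [h'] restricts to the blocks of [w]. By [hB], the default [nc_bot] of
   [insubd] does not interfere on the family summed over. *)
pose h (f : {ffun {set 'I_N} -> {set {set 'I_N}}}) : NC N :=
  insubd (nc_bot N) (\bigcup_(B in blocks w) f B).
pose h' v : {ffun {set 'I_N} -> {set {set 'I_N}}} :=
  [ffun B => if B \in blocks w then blocks v ::&: B else set0].
have hB f : f \in pfamily set0 (mem (blocks w)) (fun B => [pred p | ncp B p]) ->
    blocks (h f) = \bigcup_(B in blocks w) f B.
  move=> /pfamilyP[_ ff]; rewrite [LHS]val_insubd ifT //.
  have pf B : B \in blocks w -> partition (f B) B by move=> /ff /andP[].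
  have nf B : B \in blocks w -> noncrossing (f B) by move=> /ff /andP[].
  apply/andP; split.
    apply: partitionI.
    - by move=> D /bigcupP[B Bw] /(partition_neq0 (pf B Bw)).
    - by move=> D _; apply: subsetT.
    - move=> x _.
      have [B Bw xB] := partition_cover (blocks_partition w) (in_setT x).
      have [D Df xD] := partition_cover (pf B Bw) xB.
      by exists D => //; apply/bigcupP; exists B.
    - move=> D E x /bigcupP[B Bw Df] /bigcupP[C Cw Ef] xD xE.
      have xB := partition_mem (pf B Bw) Df xD.
      have xC := partition_mem (pf C Cw) Ef xE.
      move: Ef; rewrite -(partition_eq_block (blocks_partition w) Bw Cw xB xC) => Ef.
      exact: (partition_eq_block (pf B Bw) Df Ef xD).
  apply/noncrossingP => D E x y z t /bigcupP[B Bw Df] /bigcupP[C Cw Ef] xD yE zD tE xy yz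
    zt.
  have BC : B = C.
    have mB s : s \in D -> s \in B := partition_mem (pf B Bw) Df (x:=s).
    have mC s : s \in E -> s \in C := partition_mem (pf C Cw) Ef (x:=s).
    by apply: (noncrossingP _ (blocks_nc w) B C x y z t) => //; by [apply: mB | apply: mC].
  by move: Ef; rewrite -BC => Ef; apply: (noncrossingP _ (nf B Bw) D E x y z t).
have h'P v : (v <= w)%O -> h' v \in pfamily set0 (mem (blocks w)) (fun B =>
  [pred p | ncp B p]).
  move=> vw; apply/pfamilyP; split.
    by apply/supportP => B; rewrite ffunE; case: ifP => // Bw; rewrite inE Bw.
  move=> B Bw; have Bw' : B \in blocks w := Bw.
  by rewrite ffunE Bw' inE; exact: nc_restrict vw Bw'.
have hK v : (v <= w)%O -> h (h' v) = v.
  move=> vw; apply: val_inj => /=; rewrite hB; last exact: h'P.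
  apply/setP => C; apply/bigcupP/idP => [[B Bw]|Cv]; first by rewrite ffunE Bw => /setIdP[].
  have [B Bw CB] := nc_leP v w vw C Cv.
  by exists B => //; rewrite ffunE Bw inE Cv.
rewrite (reindex_onto h h') //=; apply: congr_big => //.
  move=> f; apply/andP/idP => [[hw /eqP <-]|ff]; first exact: h'P.
  have /pfamilyP[f0 fp] := ff.
  split.
    apply/nc_leP => C; rewrite hB // => /bigcupP[B Bw Cf]; exists B => //.
    by have /andP[pf _] := fp B Bw; apply: partitionS pf Cf.
  apply/eqP/ffunP => B; rewrite ffunE hB //; case: ifP => Bw; last first.
    by apply/esym/eqP; move/supportP: f0 => f0; rewrite f0 // Bw.
  have /andP[pf _] := fp B Bw.
  apply/setP => C; rewrite inE; apply/andP/idP => [[/bigcupP[D Dw Cf] CB]|Cf].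
    have /andP[pD _] := fp D Dw.
    have /set0Pn[x xC] := partition_neq0 pD Cf.
    have xB := subsetP CB x xC.
    by rewrite (partition_eq_block (blocks_partition w) Bw Dw xB (partition_mem pD Cf xC)).
  by split; [apply/bigcupP; exists B|apply: partitionS pf Cf].
move=> f /andP[hw /eqP fE]; rewrite (big_blocks _ _ hw); apply: eq_bigr => B Bw.
by rewrite -{2}fE ffunE Bw.
Qed.

Lemma card_blocks v w : (v <= w)%O -> #|blocks v| =
  (\sum_(B in blocks w) #|blocks v ::&: B|)%N.
Proof.
move=> vw; rewrite -sum1_card (big_blocks _ _ vw).
by apply: eq_bigr => B _; rewrite sum1_card.
Qed.

Lemma blocks_sub_le v w : blocks w \subset blocks v -> (w <= v)%O.
Proof. by move=> /subsetP s; apply/nc_leP => B /s Bv; exists B. Qed.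

Lemma card_restrict_gt0 v w B : (v <= w)%O -> B \in blocks w -> (0 < #|blocks v ::&: B|)%N.
Proof.
move=> vw Bw; have /andP[pp _] := nc_restrict vw Bw.
have /set0Pn[x xB] := partition_neq0 (blocks_partition w) Bw.
have [C Cv _] := partition_cover pp xB.
by rewrite card_gt0; apply/set0Pn; exists C.
Qed.

Lemma card_blocks_le v w : (v <= w)%O -> (#|blocks w| <= #|blocks v|)%N.
Proof.
move=> vw; rewrite (card_blocks vw) -sum1_card; apply: leq_sum => B Bw.
exact: card_restrict_gt0 vw Bw.
Qed.

Lemma card_blocks_lt v w : (v < w)%O -> (#|blocks w| < #|blocks v|)%N.
Proof.
move=> vw; have le := ltW vw.
have [B Bw Bv] : exists2 B, B \in blocks w & B \notin blocks v.
  by apply/subsetPn; apply: contraTN vw => /blocks_sub_le wv; rewrite (le_gtF wv).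
have /andP[pp _] := nc_restrict le Bw.
have two : (1 < #|blocks v ::&: B|)%N.
  have /set0Pn[x xB] := partition_neq0 (blocks_partition w) Bw.
  have [C CvB xC] := partition_cover pp xB.
  have [Cv CB] := setIdP CvB.
  have [y yB yC] : exists2 y, y \in B & y \notin C.
    apply/subsetPn; apply: contraNN Bv => BC.
    suff <- : C = B by []. by apply/eqP; rewrite eqEsubset CB.
  have [D DvB yD] := partition_cover pp yB.
  by apply/card_gt1P; exists C, D; split=> //; apply: contraNneq yC => ->.
rewrite (card_blocks le) (bigD1 B) //= -sum1_card (bigD1 B) //= -addSn.
apply: leq_add => //; apply: leq_sum => C /andP[Cw _].
exact: card_restrict_gt0 le Cw.
Qed.

Definition hull D : {set 'I_N} :=
  [set x : 'I_N | [exists y in D, (y <= x)%N] && [exists z in D, (x <= z)%N]].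

Lemma hullP D (x : 'I_N) : reflect ((exists2 y, y \in D & (y <= x)%N) /\ (exists2 z, z
  \in D & (x <= z)%N))
  (x \in hull D).
Proof. by rewrite inE; apply: (iffP andP) => -[/exists_inP ? /exists_inP ?]; split=> //;
  apply/exists_inP. Qed.

(* Take a block of [v] inside [B] with the smallest convex hull. *)
Lemma exists_convex_block v w B : (v <= w)%O -> B \in blocks w ->
  exists D, [/\ D \in blocks v, D \subset B
    & forall x y z, x \in B -> y \in D -> z \in D -> (y < x)%N -> (x < z)%N -> x \in D].
Proof.
move=> vw Bw; have /andP[pp _] := nc_restrict vw Bw.
have /card_gt0P[D0 D0v] := card_restrict_gt0 vw Bw.
case: (@arg_minnP _ D0 (fun D => D \in blocks v ::&: B) (fun D => #|hull D|) D0v).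
move=> D /setIdP[Dv DB] Dmin; exists D; split=> // x y z xB yD zD yx xz.
have [E EvB xE] := partition_cover pp xB.
have [Ev EB] := setIdP EvB.
apply: contraT => xD.
have DE : D = E -> False by move=> DE; rewrite DE xE in xD.
(* A block [E] with a point [x] strictly between [y] and [z] in [D] is trapped in that gap, since
   leaving it would create a crossing. Its hull is then strictly smaller than that of [D]. *)
have hE s : s \in E -> (y < s)%N /\ (s < z)%N.
  move=> sE; split.
    rewrite ltnNge leq_eqVlt; apply/negP => /orP[/eqP/val_inj sy|sy].
      by apply: DE; apply: (partition_eq_block (blocks_partition v) Dv Ev yD); rewrite -sy.
    by apply: DE; rewrite (noncrossingP _ (blocks_nc v) E D s y x z).
  rewrite ltnNge leq_eqVlt; apply/negP => /orP[/eqP/val_inj sz|zs].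
    by apply: DE; apply: (partition_eq_block (blocks_partition v) Dv Ev zD); rewrite sz.
  by apply: DE; rewrite (noncrossingP _ (blocks_nc v) D E y x z s).
have := Dmin E EvB; rewrite leqNgt => /negP[]; apply: proper_card; apply/properP; split.
  apply/subsetP => s /hullP[[p pE ps] [q qE sq]]; apply/hullP; split.
    by exists y => //; apply: leq_trans ps; have [/ltnW] := hE p pE.
  by exists z => //; apply: (leq_trans sq); have [_ /ltnW] := hE q qE.
exists y; first by apply/hullP; split; exists y.
apply/negP => /hullP[[p pE py] _]; have [] := hE p pE.
by rewrite ltnNge py.
Qed.

(** A block [B] of [w] that is not a block of [v] is cut into [D] and [B :\: D], where [D] is a
    block of [v] convex inside [B]. Were these two to cross, a point of [B :\: D] would lie between
    two points of [D]. *)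
Lemma split_block v w : (v < w)%O ->
  exists u, [/\ (v <= u)%O, (u < w)%O & #|blocks u| = #|blocks w|.+1].
Proof.
move=> vw; have le := ltW vw.
have [B Bw Bv] : exists2 B, B \in blocks w & B \notin blocks v.
  by apply/subsetPn; apply: contraTN vw => /blocks_sub_le wv; rewrite (le_gtF wv).
have [D [Dv DB conv]] := exists_convex_block le Bw.
have DnB : D != B by apply: contraNneq Bv => <-.
have pw := blocks_partition w.
have p1 := partitionD1 pw Bw.
have D0 := partition_neq0 (blocks_partition v) Dv.
have BD0 : B :\: D != set0.
  by apply: contra DnB; rewrite setD_eq0 => BD; rewrite eqEsubset DB.
pose p := D |: ((B :\: D) |: (blocks w :\ B)).
have p2 : partition ((B :\: D) |: (blocks w :\ B)) ((B :\: D) :|: (setT :\: B)).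
  apply: partitionU1 => //; rewrite -setI_eq0; apply/eqP/setP => x; rewrite !inE.
  by case: (x \in B); rewrite ?andbF.
have pp : partition p setT.
  have -> : setT = D :|: ((B :\: D) :|: (setT :\: B)).
    apply/setP => x; rewrite !inE; case: (x \in D) => //=; by case: (x \in B).
  apply: partitionU1 => //; rewrite -setI_eq0; apply/eqP/setP => x; rewrite !inE.
  by have [/(subsetP DB)->|//] := boolP (x \in D).
have pB F : F \in p -> [\/ F = D, F = B :\: D | (F \in blocks w) /\ (F != B)].
  by case/setU1P => [|/setU1P[|/setD1P[]]]; [constructor 1|constructor 2|constructor 3].
have psub F : F \in p -> exists2 F', F' \in blocks w & F \subset F'.
  by case/pB => [->|->|[Fw _]]; [exists B|exists B => //; apply: subsetDl|exists F].
have ncu : noncrossing p.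
  apply/noncrossingP => F G x y z t Fp Gp xF yG zF tG xy yz zt.
  have [F' Fw /subsetP FF] := psub F Fp; have [G' Gw /subsetP GG] := psub G Gp.
  have E : F' = G' by apply: (noncrossingP _ (blocks_nc w) F' G' x y z t); auto.
  have mB H H' : H \in blocks w -> H' \in blocks w -> {subset H <= H'} -> H = H'.
    move=> Hw H'w sub; have /set0Pn[s sH] := partition_neq0 pw Hw.
    exact: (partition_eq_block pw Hw H'w sH (sub s sH)).
  have FB (H : {set 'I_N}) s : s \in H -> s \in B -> H \in blocks w -> H = B.
    by move=> sH sB Hw; apply: (partition_eq_block pw Hw Bw sH sB).
  case: (pB F Fp) => [FE|FE|[Fw' FnB]]; case: (pB G Gp) => [GE|GE|[Gw' GnB]];
    try subst F; try subst G.
  - by [].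
  - have /setDP[yB /negP[]] := yG; exact: (conv y x z).
  - case/eqP: GnB; rewrite (mB G G') //.
    rewrite -E; apply: (FB _ x) => //; first exact: FF. exact: (subsetP DB).
  - have /setDP[zB /negP[]] := zF; exact: (conv z y t).
  - by [].
  - case/eqP: GnB; rewrite (mB G G') //.
    rewrite -E; apply: (FB _ x) => //; first exact: FF. by case/setDP: xF.
  - case/eqP: FnB; rewrite (mB F F') // E.
    apply: (FB _ y) => //; first exact: GG. exact: (subsetP DB).
  - case/eqP: FnB; rewrite (mB F F') // E.
    apply: (FB _ y) => //; first exact: GG. by case/setDP: yG.
  - by rewrite (mB F F') // (mB G G').
have pu : is_nc_partition p by rewrite /is_nc_partition pp.
pose u : NC N := NCPartition pu; exists u.
have cu : #|blocks u| = #|blocks w|.+1.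
  have nD : D \notin (B :\: D) |: (blocks w :\ B).
    have /set0Pn[x xD] := D0.
    apply/negP => /setU1P[DE|/setD1P[_ Dw]].
      by move: (xD); rewrite DE inE xD.
    by case/eqP: DnB; apply: (partition_eq_block pw Dw Bw xD (subsetP DB x xD)).
  have nBD : B :\: D \notin blocks w :\ B.
    have /set0Pn[x /setDP[xB xD]] := BD0.
    apply/negP => /setD1P[/eqP nE BDw]; apply: nE.
    have xBD : x \in B :\: D by rewrite inE xD xB.
    exact: (partition_eq_block pw BDw Bw xBD xB).
  by rewrite /= /p !cardsU1 nD nBD (cardsD1 B (blocks w)) Bw !add1n.
have uw : (u <= w)%O by apply/nc_leP.
split=> //; last first.
  rewrite lt_neqAle uw andbT; apply/eqP => E; move: cu; rewrite E.
  by move/eqP; rewrite -[X in X == _]addn0 -addn1 eqn_add2l.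
apply/nc_leP => C Cv; have [F Fw CF] := nc_leP v w le C Cv.
have [FB|FB] := eqVneq F B; last by exists F; rewrite //= /p !inE Fw FB !orbT.
have [CD|CD] := eqVneq C D; first by exists D; rewrite ?CD // /= /p setU11.
exists (B :\: D); first by rewrite /= /p !inE eqxx orbT.
rewrite subsetD -FB CF /=.
exact: (trivIsetP (partition_trivIset (blocks_partition v))).
Qed.

(** The number of blocks strictly decreases along a chain, which bounds its length; repeated use of
    [split_block] produces a chain that attains the bound. *)
Lemma nc_interval_rank v w : (v <= w)%O ->
  interval_rank v w = (#|blocks v| - #|blocks w|)%N.
Proof.
move=> vw; apply/eqP; rewrite eqn_leq; apply/andP; split.
  apply/bigmax_leqP => A /andP[/'forall_in_forall_inP chA /forall_inP subA].
  pose f (x : NC N) : 'I_(#|blocks v| - #|blocks w|).+1 := inord (#|blocks v| - #|blocks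
    x|).
  have bnd x : x \in A -> (#|blocks w| <= #|blocks x| <= #|blocks v|)%N.
    by move=> /subA /andP[vx xw]; rewrite !card_blocks_le.
  have finj : {in A &, injective f}.
    move=> x y xA yA /(congr1 val) /=; have bx := bnd x xA; have by_ := bnd y yA.
    rewrite !inordK ?ltnS ?leq_sub2l //; last 2 first.
    - by case/andP: by_.
    - by case/andP: bx.
    move=> E; have {E} E : #|blocks x| = #|blocks y| by move: bx by_ E; lia.
    apply/eqP; apply: contraT => xy; have /orP[] := chA x xA y yA.
      by rewrite le_eqVlt (negbTE xy) /= => /card_blocks_lt; rewrite E ltnn.
    by rewrite le_eqVlt eq_sym (negbTE xy) /= => /card_blocks_lt; rewrite E ltnn.
  have : (#|f @: A| <= (#|blocks v| - #|blocks w|).+1)%N.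
    by rewrite -[X in (_ <= X)%N]card_ord max_card.
  by rewrite (card_in_imset finj); case: #|A|.
suff [A chA ->] : exists2 A : {set NC N},
    is_chain A && [forall x in A, (v <= x <= w)%O] & (#|blocks v| - #|blocks w|)%N =
      #|A|.-1.
  exact: leq_bigmax_cond.
move: {2}(#|blocks v| - #|blocks w|)%N (erefl (#|blocks v| - #|blocks w|)%N) => k.
suff: (#|blocks v| - #|blocks w|)%N = k -> exists2 A : {set NC N},
    is_chain A && [forall x in A, (v <= x <= w)%O] & k.+1 = #|A|.
  by move=> h E; have [A chA cA] := h E; exists A => //; rewrite E -cA.
elim: k w vw => [|k IH] w vw ck.
  exists [set w]; rewrite ?cards1 //; apply/andP; split.
    by apply/'forall_in_forall_inP => x /set1P-> y /set1P->; rewrite /Order.comparable lexx.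
  by apply/forall_inP => x /set1P->; rewrite vw lexx.
have [E|ne] := eqVneq v w; first by move: ck; rewrite E subnn.
have lt : (v < w)%O by rewrite lt_neqAle ne.
have [u [vu uw cu]] := split_block lt.
have [|A /andP[chA /forall_inP subA] cA] := IH u vu; first by rewrite cu; lia.
have ltA x : x \in A -> (x < w)%O by move=> /subA /andP[_ /le_lt_trans]; apply.
exists (w |: A); last first.
  rewrite cardsU1 -cA; suff -> : w \notin A by [].
  by apply/negP => /ltA; rewrite ltxx.
apply/andP; split.
  apply/'forall_in_forall_inP => x /setU1P[->|xA] y /setU1P[->|yA].
  - by rewrite /Order.comparable lexx.
  - by rewrite /Order.comparable (ltW (ltA y yA)) orbT.
  - by rewrite /Order.comparable (ltW (ltA x xA)).
  - by move/'forall_in_forall_inP: chA => h; apply: h.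
apply/forall_inP => x /setU1P[->|xA]; first by rewrite vw lexx.
by have /andP[-> _] := subA x xA; rewrite (ltW (ltA x xA)).
Qed.

End NoncrossingLattice.

(** * Chow polynomials in the incidence algebra *)

Section ChowRecursion.
Context {d : Order.disp_t} {P : finPOrderType d}.
Implicit Types s u v w y : P.

Lemma mobius_suml s w : \sum_(v | (s <= v <= w)%O) mobius s v = (s == w)%:R.
Proof.
have [sw|sw] := boolP (s <= w)%O; last first.
  rewrite big_pred0 => [|v]; last first.
    by apply/negbTE; apply: contraNN sw => /andP[]; apply: le_trans.
  by case: eqP sw => // ->; rewrite lexx.
rewrite (bigD1 w) /=; last by rewrite sw lexx.
have -> : \sum_(v | (s <= v <= w)%O && (v != w)) mobius s v =
  \sum_(v | (s <= v < w)%O) mobius s v.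
  by apply: eq_bigl => v; rewrite [(v < w)%O]lt_neqAle andbA andbAC.
move: sw; rewrite le_eqVlt => /orP[/eqP ->|sw].
  rewrite mobius_refl eqxx big_pred0 ?addr0 // => v.
  by apply/negbTE/negP => /andP[/le_lt_trans h /h]; rewrite ltxx.
by rewrite mobius_lt // addNr (lt_eqF sw).
Qed.

(** The recurrence says that [mobius] is a left inverse of zeta; for square matrices a left inverse
    is also a right inverse. *)
Lemma mobius_sumr s w : \sum_(v | (s <= v <= w)%O) mobius v w = (s == w)%:R.
Proof.
pose e i : P := @enum_val P predT i.
pose Z : 'M[int]_#|P| := \matrix_(i, j) (e i <= e j)%O%:R.
pose M : 'M[int]_#|P| := \matrix_(i, j) (mobius (e i) (e j) *+ (e i <= e j)%O).
have sumE (F : P -> int) : \sum_(i < #|P|) F (e i) = \sum_v F v.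
  by rewrite [RHS](reindex e) //=; apply: onW_bij; exact: enum_val_bij.
have MZ : M *m Z = 1%:M.
  apply/matrixP => i j; rewrite !mxE.
  under eq_bigr => k _ do rewrite !mxE.
  rewrite (sumE (fun v => mobius (e i) v *+ (e i <= v)%O * (v <= e j)%O%:R)).
  rewrite -(inj_eq enum_val_inj) -mobius_suml [RHS]big_mkcond /=; apply: eq_bigr => v _.
  by case: (_ <= v)%O; case: (v <= _)%O; rewrite /= ?mulr1 ?mulr0 ?mulr1n ?mulr0n ?mul0r.
have := mulmx1C MZ => /matrixP/(_ (enum_rank s) (enum_rank w)); rewrite !mxE.
under eq_bigr => k _ do rewrite !mxE.
rewrite (sumE (fun v => (e (enum_rank s) <= v)%O%:R * (mobius v (e (enum_rank w)) *+ (v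
  <= e (enum_rank w))%O))).
rewrite /e !enum_rankK (inj_eq enum_rank_inj) => <-.
rewrite big_mkcond /=; apply: eq_bigr => v _.
by case: (s <= v)%O; case: (v <= w)%O; rewrite /= ?mul1r ?mulr0 ?mulr1n ?mulr0n ?mul0r.
Qed.

Lemma interval_rank_refl s : interval_rank s s = 0%N.
Proof.
apply/eqP; rewrite -leqn0; apply/bigmax_leqP => A /andP[_ /forall_inP As].
suff : (#|A| <= 1)%N by case: #|A| => [|[]].
rewrite -(cards1 s); apply/subset_leq_card/subsetP => x /As.
by rewrite -eq_le => /eqP->; rewrite set11.
Qed.

Lemma poset_charpoly_refl s : poset_charpoly s s = 1.
Proof.
rewrite /poset_charpoly (big_pred1 s) => [|v]; last by rewrite -eq_le eq_sym.
by rewrite mobius_refl interval_rank_refl expr0 scale1r.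
Qed.

(** This is the defining recurrence multiplied by [X - 1], with the term [v = s] moved into the sum.
    The last summand corrects the case [s = w], where the left side is [X] and the sum is 1. *)
Lemma chow_charpoly_sum s w : (s <= w)%O ->
  'X * chow s w = \sum_(v | (s <= v <= w)%O) poset_charpoly s v * chow v w + (s == w)%:R
    * ('X - 1).
Proof.
rewrite le_eqVlt => /orP[/eqP->|sw].
  rewrite eqxx (big_pred1 w) => [|v]; last by rewrite -eq_le eq_sym.
  by rewrite poset_charpoly_refl chow_refl /=; ring.
rewrite (lt_eqF sw) mul0r addr0 (bigD1 s) /=; last by rewrite lexx ltW.
rewrite poset_charpoly_refl mul1r.
have -> : \sum_(v | (s <= v <= w)%O && (v != s)) poset_charpoly s v * chow v w =
          ('X - 1) * chow s w.
  rewrite chow_lt // big_distrr /=; apply: congr_big => // [v|v /andP[/andP[sv vw] vs]].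
    by rewrite [(s < v)%O]lt_neqAle eq_sym andbC andbA.
  by rewrite -reduced_charpolyK ?lt_neqAle 1?eq_sym ?vs //; ring.
ring.
Qed.

(* In the incidence algebra, with [kappa s v = X^rho(s, v)], this reads
   [(kappa - X zeta) H = (1 - X) zeta]. *)
Lemma chow_rank_sum s w : (s <= w)%O ->
  \sum_(v | (s <= v <= w)%O) ('X^(interval_rank s v) - 'X) * chow v w = 1 - 'X.
Proof.
move=> sw.
(* Multiply [chow_charpoly_sum] by zeta on the left. The characteristic polynomials are [mu kappa]
   in the incidence algebra, so zeta cancels [mu] by [mobius_sumr] and leaves [kappa]. *)
have E : \sum_(u | (s <= u <= w)%O) 'X * chow u w =
    \sum_(v | (s <= v <= w)%O) 'X^(interval_rank s v) * chow v w + ('X - 1).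
  transitivity (\sum_(u | (s <= u <= w)%O)
     (\sum_(v | (u <= v <= w)%O) poset_charpoly u v * chow v w + (u == w)%:R * ('X - 1))).
    by apply: eq_bigr => u /andP[_ uw]; exact: chow_charpoly_sum.
  rewrite big_split /=; congr (_ + _); last first.
    rewrite (bigD1 w) /=; last by rewrite sw lexx.
    rewrite eqxx mul1r big1 ?addr0 // => u /andP[_ /negbTE->]; exact: mul0r.
  rewrite (exchange_big_dep (fun v => (s <= v <= w)%O)) /=; last first.
    by move=> u v /andP[su uw] /andP[uv ->]; rewrite (le_trans su uv).
  apply: eq_bigr => v /andP[sv vw]; rewrite -big_distrl /=; congr (_ * _).
  rewrite /poset_charpoly.
  transitivity (\sum_(u | (s <= u <= v)%O) \sum_(y | (u <= y <= v)%O)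
       mobius u y *: 'X^(interval_rank y v) : {poly int}).
    apply: eq_bigl => u; rewrite vw andbT; case: (s <= u)%O => //=.
    by apply/andP/idP => [[] //|uv]; rewrite uv (le_trans uv vw).
  rewrite (exchange_big_dep (fun y => (s <= y <= v)%O)) /=; last first.
    by move=> u y /andP[su uv] /andP[uy ->]; rewrite (le_trans su uy).
  transitivity (\sum_(y | (s <= y <= v)%O) (s == y)%:R *: 'X^(interval_rank y v) : {poly
    int}).
    apply: eq_bigr => y /andP[sy yv]; rewrite -scaler_suml -mobius_sumr; congr (_ *: _).
    apply: eq_bigl => u; rewrite yv andbT; case: (s <= u)%O => //=.
    by apply/andP/idP => [[] //|uy]; rewrite uy (le_trans uy yv).
  rewrite (bigD1 s) /=; last by rewrite lexx.
  rewrite eqxx scale1r big1 ?addr0 // => y /andP[_]; rewrite eq_sym => /negbTE->.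
  exact: scale0r.
under eq_bigr => v _ do rewrite mulrBl.
by rewrite sumrB E; ring.
Qed.

End ChowRecursion.

Lemma natr_poly_int_eq0 n : (n%:R == 0 :> {poly int}) = (n == 0%N).
Proof. by rewrite -polyC_natr polyC_eq0 pnatr_eq0. Qed.

Lemma lagr1 (A : comNzRingType) m k : lagr (1 : {poly A}) m k = (m == k)%:R.
Proof.
elim: m k => [|m IH] [|k] //.
rewrite (@lagrSS _ _ _ _ m.+1) // big_ord_recl big1 ?addr0 => [|i _].
  by rewrite coef1 mul1r addn0 IH.
by rewrite coef1 mul0r.
Qed.

(** * Weights on noncrossing partitions and the recursion for Chow polynomials *)

Section NoncrossingWeights.
Variable N : nat.
Implicit Types (phi psi : {poly {poly int}}) (q : {poly int}) (v w : NC N).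

Definition nc_weight phi v : {poly int} := \prod_(C in blocks v) lagr phi #|C| 1.

Lemma nc_block_card v C : C \in blocks v -> (0 < #|C| <= N)%N.
Proof.
move=> Cv; rewrite card_gt0 (partition_neq0 (blocks_partition v) Cv) /=.
by rewrite -[X in (_ <= X)%N]card_ord max_card.
Qed.

Lemma eq_nc_weight phi psi v : (forall i, (i < N)%N -> phi`_i = psi`_i) ->
  nc_weight phi v = nc_weight psi v.
Proof.
move=> e; apply: eq_bigr => C /nc_block_card/andP[_ CN].
by apply: eq_lagr => i iC; apply: e; apply: leq_trans iC CN.
Qed.

(** The rank of [[v, w]] is [#|blocks v| - #|blocks w|]. After multiplication by [q^#|blocks w|]
    each block of [v] carries one factor [q], the sum factors over the blocks of [w], and in each
    block [ncsum_lagr] and [lagr_comp] apply. *)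
Lemma nc_weight_conv phi q w : q != 0 ->
  \sum_(v | (v <= w)%O) nc_weight phi v * q ^+ interval_rank v w
    = nc_weight (phi * (1 + q *: 'X)) w.
Proof.
(* [gamma] is [1 + q y], truncated beyond the block sizes. Its positive coefficients are the weights
   [q [u^i] y], and its constant term is 1, as [ncsum_lagr] requires. *)
move=> q0; pose gamma := 1 + q *: \poly_(i < N.+2) lagr phi i 1.
have g0 : gamma`_0 = 1 by rewrite coefD coef1 coefZ coef_poly lagr0 mulr0 addr0.
have gS i : (0 < i <= N)%N -> gamma`_i = q * lagr phi i 1.
  case: i => // i iN; rewrite coefD coef1 add0r coefZ coef_poly ifT //.
  by rewrite ltnS (leq_trans iN).
have prodE (F : {set 'I_N} -> {poly int}) v :
    \prod_(C in blocks v) (q * F C) = q ^+ #|blocks v| * \prod_(C in blocks v) F C.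
  by rewrite big_split /= prodr_const.
apply: (mulfI (expf_neq0 #|blocks w| q0)); rewrite -prodE.
transitivity (\sum_(v | (v <= w)%O) \prod_(C in blocks v) gamma`_#|C|).
  rewrite big_distrr /=; apply: eq_bigr => v vw.
  under [RHS]eq_bigr => C /nc_block_card CN do rewrite gS //.
  rewrite prodE nc_interval_rank // mulrCA -exprD subnKC ?card_blocks_le //.
  by rewrite mulrC.
rewrite (nc_interval_sum (fun i => gamma`_i)); apply: eq_bigr => B /nc_block_card BN.
rewrite (ncsum_lagr g0); case: #|B| BN => // b /andP[_ bN].
by rewrite /gamma (lagr_comp natr_poly_int_eq0) // ltnS ltnW.
Qed.

(** For [phi = 1] the series [y] is [u], so a block has nonzero weight only if it is a singleton. *)
Lemma nc_weight1 v : nc_weight 1 v = (v == \bot)%O%:R.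
Proof.
rewrite /nc_weight; have [->|vb] := eqVneq v (\bot)%O.
  apply: big1 => C /imsetP[x _ ->];
    rewrite lagr1 (_ : [set y in _ | _] = [set x]) ?cards1 //.
  by apply/setP => y; rewrite !inE eq_sym.
have [C Cv C1] : exists2 C, C \in blocks v & #|C| != 1%N.
  apply/exists_inP; apply: contraR vb; rewrite negb_exists_in => /forall_inP h.
  rewrite eq_le le0x andbT; apply/nc_leP => C Cv.
  have := h C Cv; rewrite negbK => /cards1P[x E].
  exists (pblock (nc_bot N) x).
    by rewrite pblock_mem // (cover_partition (blocks_partition (nc_bot N))) inE.
  by rewrite E sub1set mem_pblock (cover_partition (blocks_partition (nc_bot N))) inE.
by rewrite (bigD1 C) //= lagr1 (negbTE C1) mul0r.
Qed.

Lemma nc_weight_top phi : (0 < N)%N -> nc_weight phi (\top)%O = lagr phi N 1.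
Proof.
move=> N0; rewrite /nc_weight (_ : blocks _ = [set setT]) ?big_set1 ?cardsT ?card_ord //.
have h (x : 'I_N) : [set y in setT | tt == tt] = setT :> {set 'I_N}.
  by apply/setP => y; rewrite !inE.
apply/setP => B; rewrite in_set1; apply/imsetP/eqP => [[x _ ->]|->].
  exact: h.
by exists (Ordinal N0) => //; rewrite h //; exact: (Ordinal N0).
Qed.

(** For [phi = Psi^k], with [1 / (1 + X u)] truncated, these are the numbers [a_k]. *)
Definition weighted_chow phi : {poly int} :=
  \sum_v nc_weight phi v * chow v (\top)%O.

Lemma weighted_chow1 : weighted_chow 1 = chow_poly (NC N).
Proof.
rewrite /weighted_chow (bigD1 (\bot)%O) //= nc_weight1 eqxx mul1r big1 ?addr0 //.
by move=> v /negbTE vb; rewrite nc_weight1 vb mul0r.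
Qed.

(** Apply the row vector [F_phi] to [(kappa - X zeta) H = (1 - X) zeta] at the top element. By
    [nc_weight_conv], [F_phi kappa = F_(phi (1 + X u))] and [F_phi zeta = F_(phi (1 + u))]. In
    ['X *: 'X] the scalar is [X] and the polynomial is [u]. *)
Lemma weighted_chow_rec phi : (0 < N)%N ->
  weighted_chow (phi * (1 + 'X *: 'X)) =
    'X * weighted_chow (phi * (1 + 'X)) + (1 - 'X) * lagr (phi * (1 + 'X)) N 1.
Proof.
move=> N0; rewrite -nc_weight_top //.
have E1 w : \sum_(v | (v <= w)%O) nc_weight phi v = nc_weight (phi * (1 + 'X)) w.
  rewrite -[X in 1 + X]scale1r -nc_weight_conv ?oner_eq0 //.
  by apply: eq_bigr => v _; rewrite expr1n mulr1.
have X0 : 'X != 0 :> {poly int} by rewrite polyX_eq0.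
have EX w := nc_weight_conv phi w X0.
move: EX E1; move: (phi * (1 + 'X *: 'X)) => psiX EX; move: (phi * (1 + 'X)) => psi1 E1.
have -> : (1 - 'X) * nc_weight psi1 (\top)%O =
  \sum_s nc_weight phi s * (\sum_(v | (s <= v <= (\top)%O)%O) ('X^(interval_rank s v) -
    'X) * chow v (\top)%O).
  rewrite -E1 mulrC big_distrl /=; apply: congr_big => //; first by move=> v; rewrite lex1.
  by move=> v _; rewrite chow_rank_sum ?lex1.
under [X in _ = _ + X]eq_bigr => s _ do rewrite big_distrr /=.
rewrite (exchange_big_dep xpredT) //= /weighted_chow big_distrr -big_split /=.
apply: eq_bigr => w _; rewrite (eq_bigl (fun v => (v <= w)%O)); last by move=> v;
  rewrite lex1 andbT.
under [X in _ = _ + X]eq_bigr => v _ do rewrite mulrA.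
rewrite -big_distrl /= -E1 -EX mulrA -mulrDl; congr (_ * _).
rewrite big_distrr -big_split /=; apply: eq_bigr => v _.
by rewrite mulrBr addrC (mulrC 'X) subrK.
Qed.

(* [trunc_inv] inverts [1 + X u] modulo [u ^+ N]. *)
Definition trunc_inv : {poly {poly int}} := \poly_(i < N) (- 'X) ^+ i.

(** The recursion is unfolded [K] times from [Psi^0 = 1]; the remainder [X^K r] does not affect the
    coefficients below [K]. Lagrange inversion evaluates [N [u^N] y_(k+1)]. *)
Lemma chow_nc_expansion K : (0 < N)%N -> exists r,
  N%:R * chow_poly (NC N) =
    (1 - 'X) * \sum_(k < K) 'X^k * (((1 + 'X) * trunc_inv) ^+ (k.+1 * N))`_N.-1 + 'X^K * r.
Proof.
move=> N0.
pose psi k := ((1 + 'X) * trunc_inv) ^+ k : {poly {poly int}}.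
suff [r E] : exists r, chow_poly (NC N) =
    (1 - 'X) * \sum_(k < K) 'X^k * lagr (psi k.+1) N 1 + 'X^K * r.
  exists (N%:R * r); rewrite E mulrDr mulrCA [_ * ('X^K * _)]mulrCA; congr (_ * _ + _).
  rewrite big_distrr; apply: eq_bigr => k _ /=; rewrite mulrCA; congr (_ * _).
  by rewrite (lagr_inversion natr_poly_int_eq0) // mul1r subn1 -exprM.
have rec k : weighted_chow (psi k) =
    'X * weighted_chow (psi k.+1) + (1 - 'X) * lagr (psi k.+1) N 1.
  (* Then [phi (1 + u)] is exactly [Psi^(k+1)], while [phi (1 + X u)] agrees with [Psi^k] only
     modulo [u^N], which suffices by [eq_nc_weight]. *)
  pose phi := psi k * trunc_inv.
  have -> : psi k.+1 = phi * (1 + 'X) by rewrite /phi /psi exprSr -[RHS]mulrA (mulrC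
    trunc_inv).
  rewrite -weighted_chow_rec //; apply: eq_bigr => v _; congr (_ * _).
  apply: eq_nc_weight => i iN.
  have T : trunc_inv * (1 + 'X *: 'X) = 1 - ((- 'X) ^+ N) *: 'X^N.
    apply/polyP => j; rewrite mulrDr mulr1 -scalerAr coefD coefZ coefMX coefB coef1 coefZ
      coefXn.
    rewrite !coef_poly; case: j => [|j] /=.
      by rewrite N0 mulr0 addr0 expr0 (ltn_eqF N0) mulr0 subr0.
    rewrite add0r; case: (ltngtP j.+1 N) => jN.
    - by rewrite /= exprS; ring.
    - by rewrite /=; ring.
    - by rewrite /= -jN exprS; ring.
  rewrite /phi -mulrA T mulrBr mulr1 coefB -scalerAr coefZ coefMXn iN mulr0 subr0.
  by [].
exists (weighted_chow (psi K)); rewrite -weighted_chow1 -[1]/(psi 0).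
elim: K => [|K IH]; first by rewrite big_ord0 mulr0 add0r mul1r.
rewrite IH big_ord_recr /= rec exprS; ring.
Qed.

End NoncrossingWeights.

(** * The multisection formula *)

Lemma bin_hockey M j : (\sum_(i < j.+1) 'C(M + i, i) = 'C((M + j).+1, j))%N.
Proof.
elim: j => [|j IH]; first by rewrite big_ord_recl big_ord0 !bin0.
by rewrite big_ord_recr /= IH addnS binS addnC.
Qed.

(** These are the coefficients of [(1 - a u)^-(M+1)]; truncating the geometric series at [L] does
    not change those below [L]. *)
Lemma coef_geometric_exp (A : comNzRingType) (a : A) L M j : (j < L)%N ->
  ((\poly_(i < L) a ^+ i) ^+ M.+1)`_j = a ^+ j * 'C(M + j, j)%:R.
Proof.
elim: M j => [|M IH] j jL; first by rewrite expr1 coef_poly jL binn mulr1.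
rewrite exprSr coefM.
transitivity (\sum_(i < j.+1) a ^+ j * 'C(M + i, i)%:R).
  apply: eq_bigr => i _; have ij : (i <= j)%N by rewrite -ltnS.
  rewrite IH ?(leq_ltn_trans ij) // coef_poly (leq_ltn_trans (leq_subr _ _)) //.
  by rewrite mulrAC -exprD subnKC.
by rewrite -big_distrr /= -natr_sum bin_hockey.
Qed.

Lemma bin_chain a b c : (c <= b)%N -> (b <= a)%N ->
  ('C(a, b) * 'C(b, c) = 'C(a, c) * 'C(a - c, b - c))%N.
Proof.
move=> cb ba; have ca := leq_trans cb ba.
have h : (0 < c`! * (b - c)`! * (a - b)`!)%N by rewrite !muln_gt0 !fact_gt0.
apply/eqP; rewrite -(eqn_pmul2r h); apply/eqP.
have E1 := bin_fact ba; have E2 := bin_fact cb; have E3 := bin_fact ca.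
have E4 : ('C(a - c, b - c) * ((b - c)`! * (a - b)`!) = (a - c)`!)%N.
  rewrite -(bin_fact (leq_sub2r c ba)); congr (_ * (_ * _`!))%N; lia.
transitivity a`!; first by rewrite -E1 -E2; ring.
by rewrite -E3 -E4; ring.
Qed.

(** Written with [c_j = C(n-1, j) C(M+j, n)], the right side is [c_j + c_(j-1)], which lets a factor
    [1 - X] be extracted from the alternating sum in [coef_kreweras_exp]. *)
Lemma bin_split n M j : (0 < j <= n)%N -> (n < M)%N ->
  ('C(M, n - j) * 'C(M + j.-1, j) =
    'C(n.-1, j) * 'C(M + j, n) + 'C(n.-1, j.-1) * 'C(M + j.-1, n))%N.
Proof.
case: j => // j /= jn nM; case: n jn nM => // n jn nM; rewrite /= in jn nM *.
rewrite ltnS in jn.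
have h : (0 < (M + j - n) * n.+1)%N by rewrite muln_gt0 subn_gt0 andbT; lia.
apply/eqP; rewrite -(eqn_pmul2r h); apply/eqP.
have B1 : (n.+1 * 'C(n, j.+1) = (n - j) * 'C(n.+1, j.+1))%N by have := mul_bin_down n.+1
  j.+1.
have B2 : (n.+1 * 'C(n, j) = j.+1 * 'C(n.+1, j.+1))%N by have := mul_bin_diag n.+1 j.
have B3 : ((M + j).+1 * 'C(M + j, n.+1) = (M + j - n) * 'C((M + j).+1, n.+1))%N.
  by have := mul_bin_down (M + j).+1 n.+1.
have B4 : (M * 'C(M.-1, n - j) = (M + j - n) * 'C(M, n - j))%N.
  by rewrite mul_bin_down; congr (_ * _)%N; lia.
have B5 := @bin_chain (M + j) n.+1 j.+1 jn (_ : n < M + j)%N.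
have {}B5 : ('C(M + j, n.+1) * 'C(n.+1, j.+1) = 'C(M + j, j.+1) * 'C(M.-1, n - j))%N.
  by rewrite B5; [congr (_ * 'C(_, _))%N; lia | lia].
rewrite subSS addnS.
transitivity (('C(M + j, n.+1) * 'C(n.+1, j.+1)) * (M * n.+1))%N.
  rewrite B5; transitivity (((M + j - n) * 'C(M, n - j)) * 'C(M + j, j.+1) * n.+1)%N;
    first by ring.
  by rewrite -B4; ring.
transitivity ((n.+1 * 'C(n, j.+1)) * ((M + j - n) * 'C((M + j).+1, n.+1)) +
   (n.+1 * 'C(n, j)) * (M + j - n) * 'C(M + j, n.+1))%N; last by ring.
rewrite B1 B2 -B3.
(* After scaling by [h], every term is a multiple of [C(n+1, j+1) C(M+j, n+1)]; this identity
   between the cofactors is all that remains. *)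
have -> : (M * n.+1 = (n - j) * (M + j).+1 + j.+1 * (M + j - n))%N.
  have [b Mb] : exists b, M = (n + b)%N by exists (M - n)%N; lia.
  have [a na] : exists a, n = (j + a)%N by exists (n - j)%N; lia.
  rewrite Mb na.
  rewrite (_ : j + a - j = a)%N; last by lia.
  rewrite (_ : j + a + b + j - (j + a) = b + j)%N; last by lia.
  ring.
ring.
Qed.

Section Multisection.
Variable n' : nat.
Let n := n'.+1.
Let N := n.+1.

(** Expanding [(1 + u)^M] and [(1 + X u)^-M] gives [\sum_j (-X)^j C(M, n-j) C(M-1+j, j)]. By
    [bin_split] each term with [j > 0] is a sum of two neighbours, so the whole is [1 - X] times a
    shorter sum. *)
Lemma coef_kreweras_exp M : (n < M)%N ->
  (((1 + 'X) * trunc_inv N) ^+ M)`_n =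
  (1 - 'X) * \sum_(j < n) (- 'X) ^+ j * ('C(n', j) * 'C(M + j, n))%N%:R :> {poly int}.
Proof.
move=> nM; rewrite exprMn addrC exprD1n coefM.
have c1 i : (\sum_(k < M.+1) 'X^k *+ 'C(M, k) : {poly {poly int}})`_i = 'C(M, i)%:R.
  rewrite coef_sum; case: (ltnP i M.+1) => iM.
    rewrite (bigD1 (Ordinal iM)) //= coefMn coefXn eqxx big1 ?addr0 //.
    move=> k kn; rewrite coefMn coefXn; case: eqP => [E|_]; last by rewrite mul0rn.
    by case/eqP: kn; apply: val_inj.
  rewrite big1 ?bin_small // => k _; rewrite coefMn coefXn; case: eqP => [E|_];
    last by rewrite mul0rn.
  by move: (ltn_ord k); rewrite -E ltnNge iM.
have M0 : M = M.-1.+1 by rewrite prednK //; apply: leq_ltn_trans nM.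
transitivity (\sum_(j < n.+1) (- 'X) ^+ j * ('C(M, n - j) * 'C(M.-1 + j, j))%N%:R : {poly
  int}).
  rewrite (reindex_inj rev_ord_inj) /=; apply: eq_bigr => j _; rewrite c1 subSS.
  have jn : (j <= n)%N by rewrite -ltnS.
  rewrite subKn // {2}M0 /trunc_inv coef_geometric_exp ?ltnS //.
  by rewrite natrM; ring.
rewrite mulrBl mul1r big_ord_recl expr0 mul1r subn0 bin0 muln1.
rewrite big_distrr /= -sumrN [in RHS]big_ord_recl /= expr0 mul1r bin0 mul1n addn0.
rewrite -addrA; congr (_ + _).
transitivity (\sum_(j < n) (- 'X) ^+ j.+1 * ('C(n', j.+1) * 'C(M + j.+1, n) + 'C(n', j) *
  'C(M + j, n))%N%:R : {poly int}).
  apply: eq_bigr => j _; rewrite /bump leq0n add1n -(@bin_split n M j.+1) ?ltn_ord //.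
  by rewrite M0 /= addSnnS.
transitivity (\sum_(j < n) ((- 'X) ^+ j.+1 * ('C(n', j.+1) * 'C(M + j.+1, n))%N%:R
    + (- 'X) ^+ j.+1 * ('C(n', j) * 'C(M + j, n))%N%:R) : {poly int}).
  by apply: eq_bigr => j _; rewrite -mulrDr -natrD.
rewrite big_split /=; congr (_ + _).
  rewrite big_ord_recr /= bin_small // mul0n mulr0 addr0.
  by apply: eq_bigr => j _; rewrite /bump leq0n add1n.
by apply: eq_bigr => j _; rewrite exprS; ring.
Qed.

Definition qint m : {poly int} := \poly_(i < m) 1.

Lemma qintM m : qint m * (1 - 'X) = 1 - 'X^m.
Proof.
rewrite /qint poly_def; under eq_bigr => i _ do rewrite scale1r.
by rewrite mulrC -(opprB 'X 1) mulNr -subrX1 opprB.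
Qed.

Definition chow_gen : {poly int} := qint N ^+ 2 * qint n ^+ n'.

Lemma expr_one_sub_Xn L m : exists r : {poly int}, (1 - 'X^L) ^+ m = 1 + 'X^L * r.
Proof.
elim: m => [|m [r IH]]; first by exists 0; rewrite mulr0 addr0 expr0.
by exists (r * (1 - 'X^L) - 1); rewrite exprSr IH; ring.
Qed.

Definition section_eq K (p q : {poly int}) := forall e, (e < K)%N -> p`_(N * e + 1) = q`_e.

(** Taking every [N]-th coefficient turns multiplication by [x^N] into multiplication by [X]. *)
Lemma section_eqM K p q : section_eq K p q -> section_eq K (p * (1 - 'X^N)) (q * (1 - 'X)).
Proof.
move=> pq e eK; rewrite !mulrBr !mulr1 !coefB pq // coefMXn coefMX; congr (_ - _).
case: e eK => [|e] eK; first by rewrite muln0.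
rewrite ifF; last by rewrite mulnS -addnA ltnNge leq_addr.
by rewrite mulnS -addnA addKn pq // ltnW.
Qed.

(** Below degree [K], [N H] agrees with [(1 - X)^2 Q], while [chow_gen] is
    [(1 - x^N)^2 (1 - x^n)^n' / (1 - x)^N]. By [section_eqM], used twice, only [Q] and the section
    of [(1 - x^n)^n' / (1 - x)^N] need comparing. *)
Lemma chow_nc_coef e : (N%:R * chow_poly (NC N))`_e = chow_gen`_(N * e + 1).
Proof.
pose K := e.+1; have [//|r ->] := @chow_nc_expansion N K.
rewrite coefD coefXnM ltnSn addr0.
pose Q : {poly int} := \sum_(k < K) 'X^k * \sum_(j < n) (- 'X) ^+ j * ('C(n', j) *
  'C(k.+1 * N + j, n))%N%:R.
have -> : (1 - 'X) * (\sum_(k < K) 'X^k * (((1 + 'X) * trunc_inv N) ^+ (k.+1 * N))`_N.-1)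
  = Q * (1 - 'X) * (1 - 'X).
  rewrite mulrC; congr (_ * _); rewrite big_distrl; apply: eq_bigr => k _.
  rewrite coef_kreweras_exp; first by rewrite mulrCA mulrC.
  by rewrite mulSn leq_addr.
(* [L] is one more than the index [N * e + 1] under study, so [qint L] can replace [1 / (1 - x)]. *)
pose L := (N * e + 2)%N; pose C := (1 - 'X^n) ^+ n' * qint L ^+ N : {poly int}.
have AC : chow_gen * (1 - 'X^L) ^+ N = C * (1 - 'X^N) * (1 - 'X^N).
  rewrite /chow_gen /C -!qintM; move: (qint N) (qint n) (qint L) (1 - 'X) => a b c x.
  rewrite /N /n !exprMn !exprS expr0 !mulr1;
    move: (b ^+ n') (c ^+ n') (x ^+ n') => b' c' x'; ring.
have [s Es] := expr_one_sub_Xn L N.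
have -> : chow_gen`_(N * e + 1) = (C * (1 - 'X^N) * (1 - 'X^N))`_(N * e + 1).
  rewrite -AC Es mulrDr mulr1 coefD mulrCA coefXnM /L ifT ?addr0 //.
  by rewrite ltn_add2l.
suff CQ : section_eq K C Q by rewrite (section_eqM (section_eqM CQ)).
move=> f fK.
have qL i : (i < L)%N -> (qint L ^+ N)`_i = 'C(n + i, n)%:R.
  move=> iL; have := @coef_geometric_exp int 1 L n i iL.
  rewrite (_ : \poly_(i < L) 1 ^+ i = qint L); last by apply/polyP => k;
    rewrite !coef_poly expr1n.
  by move=> ->; rewrite expr1n mul1r -[in RHS]bin_sub ?leq_addr // addKn.
have fL : (N * f + 1 < L)%N by rewrite /L; rewrite ltnS in fK; nia.
transitivity (\sum_(j < n) (if (j <= f)%N then (-1) ^+ j * ('C(n', j) * 'C((f - j).+1 * N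
  + j, n))%N%:R else 0 : int)).
  rewrite /C -[1 - 'X^n]addrC exprD1n big_distrl coef_sum; apply: eq_bigr => j _.
  have jn : (j <= n')%N by rewrite -ltnS.
  have sg : (-1) ^+ j = ((-1) ^+ j)%:P :> {poly int} by rewrite polyC_exp polyCN.
  rewrite /= (exprNn 'X^n j) sg -exprM mulrnAl -mulrA coefMn coefCM coefXnM.
  case: (leqP j f) => jf.
    have ij : (n * j <= N * f + 1)%N by rewrite addn1 leqW // leq_mul.
    rewrite ltnNge ij /= qL; last by apply: leq_ltn_trans fL; exact: leq_subr.
    (* Since [N = n + 1], the residue 1 makes this index match the binomial of [Q] with
       [k = f - j]. *)
    rewrite (_ : n + (N * f + 1 - n * j) = (f - j).+1 * N + j)%N.
      by rewrite natrM -mulr_natl; ring.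
    have [g ->] : exists g, f = (j + g)%N by exists (f - j)%N; rewrite subnKC.
    rewrite addKn (_ : N * (j + g) + 1 = n * j + (j + N * g + 1))%N; last by rewrite /N;
      nia.
    by rewrite addKn /N; nia.
  (* Here [f < j < n], so [n * j] exceeds [N * f + 1]. *)
  rewrite ifT ?mulr0 ?mul0rn // /N /n; nia.
rewrite /Q coef_sum.
transitivity (\sum_(k < K) \sum_(j < n) (if (k + j == f)%N then (-1) ^+ j * ('C(n', j) *
  'C(k.+1 * N + j, n))%N%:R else 0 : int)).
  rewrite exchange_big; apply: eq_bigr => j _ /=; case: leqP => jf; last first.
    rewrite big1 // => k _; case: eqP => // E; move: jf; by rewrite -E ltnNge leq_addl.
  have kK : (f - j < K)%N by apply: leq_ltn_trans fK; exact: leq_subr.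
  rewrite (bigD1 (Ordinal kK)) //= subnK // eqxx big1 ?addr0 // => k kn.
  case: eqP => // E; case/eqP: kn; apply: val_inj => /=; by rewrite -E addnK.
apply: eq_bigr => k _; rewrite coefXnM; case: ltnP => kf.
  rewrite big1 // => j _; case: eqP => // E; move: kf; by rewrite -E ltnNge leq_addr.
rewrite coef_sum; apply: eq_bigr => j _.
have sg : (-1) ^+ j = ((-1) ^+ j)%:P :> {poly int} by rewrite polyC_exp polyCN.
rewrite (exprNn 'X j) sg -mulrA coefCM (mulr_natr 'X^j) coefMn coefXn.
rewrite (_ : (f - k == j)%N = (k + j == f)%N); last first.
  by rewrite -(eqn_add2l k) subnKC // eq_sym.
by case: eqP => _; rewrite ?mul0rn ?mulr0 //= mulrnA.
Qed.

End Multisection.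

(** * Real-rootedness *)

Lemma big_nat_single (V : nmodType) (a b k0 : nat) (F : nat -> V) : (a <= k0 < b)%N ->
  (forall k, (a <= k < b)%N -> k != k0 -> F k = 0) -> \sum_(a <= k < b) F k = F k0.
Proof.
move=> ab F0; rewrite (bigD1_seq k0) ?iota_uniq ?mem_index_iota //=.
rewrite big_nat_cond big1 ?addr0 // => k /andP[kab kk]; exact: F0.
Qed.

Section Rotating.
Variables (R : rcfType) (N : nat) (z : R[i]).
Implicit Types (x y : R[i]) (v w : nat -> R[i]).

(** This is the imaginary part of [conj(x) y]: for nonzero [x] and [y] it is nonnegative exactly
    when [y] is reached from [x] by a counterclockwise turn of at most a half-circle. *)
Definition cross x y : R := complex.Re x * complex.Im y - complex.Im x * complex.Re y.

Lemma cross0l y : cross 0 y = 0. Proof. by rewrite /cross /= !mul0r subr0. Qed.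
Lemma cross0r x : cross x 0 = 0. Proof. by rewrite /cross /= !mulr0 subr0. Qed.
Lemma crossxx x : cross x x = 0. Proof. by rewrite /cross mulrC subrr. Qed.
Lemma crossDl x x' y : cross (x + x') y = cross x y + cross x' y.
Proof. by case: x x' y => [a b] [a' b'] [c d]; rewrite /cross /=; ring. Qed.
Lemma crossDr x y y' : cross x (y + y') = cross x y + cross x y'.
Proof. by case: x y y' => [a b] [a' b'] [c d]; rewrite /cross /=; ring. Qed.
Lemma cross_mul x : cross x (z * x) =
  (complex.Re x ^+ 2 + complex.Im x ^+ 2) * complex.Im z.
Proof. by case: x z => [a b] [c d]; rewrite /cross /=; ring. Qed.

Hypothesis z_gt0 : 0 < complex.Im z.

Lemma cross_mul_ge0 x : 0 <= cross x (z * x).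
Proof. by rewrite cross_mul mulr_ge0 ?(ltW z_gt0) // addr_ge0 ?sqr_ge0. Qed.

Lemma cross_mul_gt0 x : x != 0 -> 0 < cross x (z * x).
Proof.
move=> x0; rewrite cross_mul mulr_gt0 //.
rewrite lt_def addr_ge0 ?sqr_ge0 // andbT.
rewrite paddr_eq0 ?sqr_ge0 // !sqrf_eq0; apply: contra x0.
by case: x => a b /= /andP[/eqP-> /eqP->].
Qed.

(* The arguments of [v i, v (i + 1), ..., v (i + N) = z v i] are nondecreasing
   and their total increase is [arg z]. *)
Definition rotating v :=
  (forall i, v (i + N)%N = z * v i) /\
  (forall i j, (i <= j <= i + N)%N -> 0 <= cross (v i) (v j)).

Definition window m v i := \sum_(i <= k < i + m) v k.

Lemma rotating_shift v a b : rotating v ->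
  \sum_(a + N <= k < b + N) v k = z * \sum_(a <= k < b) v k.
Proof.
move=> [vN _]; rewrite big_addn addnK big_distrr /=.
by apply: eq_bigr => k _.
Qed.

(** By bilinearity. The bounds, which let the ranges share an endpoint, ensure [i <= j <= i + N] for
    every [i] in the first range and [j] in the second. *)
Lemma cross_sum_ge0 v a b c d : rotating v -> (b <= c.+1)%N -> (d <= (a + N).+1)%N ->
  0 <= cross (\sum_(a <= k < b) v k) (\sum_(c <= k < d) v k).
Proof.
move=> [_ vC] bc da; rewrite big_nat_cond.
elim/big_rec: _ => [|i x /andP[/andP[ai ib] _] h]; first by rewrite cross0l.
rewrite crossDl addr_ge0 // {h} big_nat_cond.
elim/big_rec: _ => [|j y /andP[/andP[cj jd] _] h]; first by rewrite cross0r.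
rewrite crossDr addr_ge0 // vC //; lia.
Qed.

Lemma rotating_window_period v m : rotating v ->
  forall i, window m v (i + N) = z * window m v i.
Proof. by move=> rv i; rewrite /window addnAC rotating_shift. Qed.

(** For [i <= k <= i + N] the two windows are [A + B] and [B + z A], where [B] is their overlap.
    Each cross term between them is nonnegative and [cross B B = 0]. *)
Lemma rotating_window_full v : rotating v -> rotating (window N v).
Proof.
move=> rv; split=> [|i k /andP[ik kN]]; first exact: rotating_window_period.
rewrite /window (big_cat_nat ik kN) /=.
rewrite [X in cross _ X](big_cat_nat (n := i + N)) ?leq_add2r //=.
have h0 : 0 <= cross (\sum_(i <= l < k) v l) (\sum_(i + N <= l < k + N) v l).
  by rewrite rotating_shift // cross_mul_ge0.
rewrite !(crossDl, crossDr) crossxx.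
have h1 := @cross_sum_ge0 v i k k (i + N) rv (leqnSn _) (leqnSn _).
have h2 := @cross_sum_ge0 v k (i + N) (i + N) (k + N) rv (leqnSn _) (leqnSn _).
by do !apply: addr_ge0 => //.
Qed.

Lemma rotating_window_pred v n : N = n.+1 -> rotating v -> rotating (window n v).
Proof.
move=> Nn rv; split=> [|i k /andP[ik kN]]; first exact: rotating_window_period.
move: ik; rewrite leq_eqVlt => /orP[/eqP <-|ik]; first by rewrite crossxx.
move: kN; rewrite leq_eqVlt => /orP[/eqP ->|kN].
  by rewrite rotating_window_period // cross_mul_ge0.
case: k ik kN => // k ik kN.
(* The windows overlap in [T]; the first misses [v (i + n)], the second starts just after [v k], and
   its tail is [S] one period later, that is [z * S]. *)
set S := \sum_(i <= l < k) v l; set T := \sum_(k.+1 <= l < i + n) v l.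
have Ei : window n v i = S + v k + T.
  rewrite /window (@big_cat_nat _ _ _ k) ?(ltnW ik) //=; last by lia.
  rewrite -addrA; congr (_ + _); rewrite big_ltn //; lia.
have Ek : window n v k.+1 = T + v (i + n)%N + z * S.
  rewrite /window (@big_cat_nat _ _ _ (i + n)) //=; try lia.
  rewrite -addrA; congr (_ + _); rewrite big_ltn; last by lia.
  congr (_ + _); rewrite -rotating_shift //; congr (\sum_(_ <= l < _) _); lia.
have one l : v l = \sum_(l <= l' < l.+1) v l' by rewrite big_nat1.
have h a b c d := @cross_sum_ge0 v a b c d rv.
rewrite Ei Ek !(crossDl, crossDr) crossxx.
have zS : z * S = \sum_(i + N <= l < k + N) v l by rewrite rotating_shift.
have hS := cross_mul_ge0 S.
have [c1 c2] : 0 <= cross S T /\ 0 <= cross S (v (i + n)%N).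
  by rewrite (one (i + n)%N); split; apply: h; lia.
have [c3 c4] : 0 <= cross (v k) T /\ 0 <= cross (v k) (v (i + n)%N).
  by rewrite (one k) (one (i + n)%N); split; apply: h; lia.
have [c5 c6] : 0 <= cross (v k) (z * S) /\ 0 <= cross T (z * S).
  by rewrite (one k) zS; split; apply: h; lia.
have c7 : 0 <= cross T (v (i + n)%N) by rewrite (one (i + n)%N); apply: h; lia.
lra.
Qed.

(** Take the cross product of the window with [z * v i = v (i + N)]: the term [v i] contributes a
    positive amount and the others a nonnegative one. *)
Lemma window_neq0 v m i : rotating v -> (0 < m <= N)%N -> v i != 0 -> window m v i != 0.
Proof.
move=> rv /andP[m0 mN] vi; apply/eqP => w0.
have : cross (window m v i) (z * v i) = 0 by rewrite w0 cross0l.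
rewrite /window big_ltn; last by lia.
rewrite crossDl; apply/eqP; rewrite gt_eqF // ltr_wpDr ?cross_mul_gt0 //.
have -> : z * v i = \sum_(i + N <= k < (i + N).+1) v k by rewrite big_nat1; case: rv => ->.
by apply: cross_sum_ge0 => //; lia.
Qed.

Implicit Types F G : {poly int}.

(** This is [F], taken as a polynomial in the shift operator, applied to [v] and evaluated at [i].
    Multiplication by [qint m] thus becomes a window sum of length [m]. *)
Definition pairing (F : {poly int}) v i : R[i] :=
  \sum_(0 <= c < size F) (F`_c)%:~R * v (i + c)%N.

Lemma pairingE F v i L : (size F <= L)%N ->
  pairing F v i = \sum_(0 <= c < L) (F`_c)%:~R * v (i + c)%N.
Proof.
move=> FL; rewrite [RHS](big_cat_nat (n := size F)) //=.
rewrite [X in _ + X]big_nat_cond [X in _ + X]big1 ?addr0 // => c /andP[/andP[Fc _] _].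
by rewrite nth_default // mul0r.
Qed.

Lemma pairingD F G v i : pairing (F + G) v i = pairing F v i + pairing G v i.
Proof.
pose L := maxn (size F) (size G).
rewrite !(@pairingE _ _ _ L) ?leq_maxl ?leq_maxr ?size_polyD //.
by rewrite -big_split; apply: eq_bigr => c _; rewrite coefD rmorphD mulrDl.
Qed.

Lemma pairing0 v i : pairing 0 v i = 0.
Proof. by rewrite /pairing size_poly0 big_geq. Qed.

Lemma pairing1 v i : pairing 1 v i = v i.
Proof. by rewrite /pairing size_poly1 big_nat1 coef1 mul1r addn0. Qed.

Lemma pairingXn F v i a : pairing ('X^a * F) v i = pairing F v (i + a).
Proof.
have sz : (size ('X^a * F)%R <= size F + a)%N.
  by rewrite (leq_trans (size_polyMleq _ _)) // size_polyXn addSn /= addnC.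
rewrite (pairingE _ _ sz) (big_cat_nat (n := a)) ?leq_addl //=.
rewrite big_nat_cond big1 ?add0r => [|c /andP[/andP[_ ca] _]]; last first.
  by rewrite coefXnM ca mul0r.
rewrite -{1}[a]add0n big_addn addnK; apply: eq_bigr => c _.
by rewrite coefXnM ltnNge leq_addl /= addnK addnAC addnA.
Qed.

Lemma pairing_qint F v m i : pairing (qint m * F) v i = window m (pairing F v) i.
Proof.
have -> : qint m * F = \sum_(a < m) 'X^a * F.
  rewrite /qint poly_def big_distrl; apply: eq_bigr => a _ /=; by rewrite scale1r.
have -> : pairing (\sum_(a < m) 'X^a * F) v i = \sum_(a < m) pairing ('X^a * F) v i.
  elim: m => [|m IH]; first by rewrite !big_ord0 pairing0.
  by rewrite !big_ord_recr /= pairingD IH.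
rewrite /window -[X in \sum_(X <= _ < _) _]add0n big_addn addKn big_mkord.
by apply: eq_bigr => a _; rewrite pairingXn addnC.
Qed.

(* Multisection modulo [N], as a pairing: see pairing_residue. *)
Definition residue_seq k : R[i] := if (N %| k)%N then z ^+ (k %/ N) else 0.

Lemma rotating_residue : (0 < N)%N -> rotating residue_seq.
Proof.
move=> N0; split=> [i|i j /andP[ij jN]]; rewrite /residue_seq.
  rewrite dvdn_addl // divnDr // divnn N0 addn1 exprS.
  by case: ifP => _; rewrite ?mulr0.
case: ifP => [/dvdnP[a Ea]|_]; last by rewrite cross0l.
case: ifP => [/dvdnP[b Eb]|_]; last by rewrite cross0r.
(* Multiples of [N] at distance at most [N] are equal or consecutive. *)
have ba : b = a \/ b = a.+1.
  have h1 : (a <= b)%N by rewrite -(leq_pmul2r N0) -Ea -Eb.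
  have h2 : (b <= a.+1)%N by rewrite -(leq_pmul2r N0) mulSn addnC -Ea -Eb.
  by lia.
rewrite Ea Eb !mulnK //; case: ba => ->; first by rewrite crossxx.
by rewrite exprS cross_mul_ge0.
Qed.

Lemma z_neq0 : z != 0.
Proof. by apply: contraTneq z_gt0 => ->; rewrite /= ltxx. Qed.

(** Among [N] consecutive indices exactly one is a multiple of [N], namely [k0], the largest one up
    to [i + N - 1]. *)
Lemma window_residue_neq0 i : (0 < N)%N -> window N residue_seq i != 0.
Proof.
move=> N0; pose k0 := ((i + N.-1) %/ N * N)%N.
have E := divn_eq (i + N.-1) N; have m := ltn_pmod (i + N.-1) N0.
rewrite /window (big_nat_single (k0 := k0)).
- by rewrite /residue_seq dvdn_mull // expf_neq0 // z_neq0.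
- rewrite /k0; lia.
move=> k /andP[ik kN] kk; rewrite /residue_seq; case: ifP => // /dvdnP[a Ea].
case/eqP: kk; rewrite /k0 (_ : i + N.-1 = a * N + (i + N.-1 - k))%N; last by lia.
by rewrite divnMDl // divn_small ?addn0 //; lia.
Qed.

Lemma eq_window v w m i : v =1 w -> window m v i = window m w i.
Proof. by move=> vw; apply: eq_bigr => k _. Qed.

Lemma eq_rotating v w : v =1 w -> rotating v -> rotating w.
Proof. by move=> vw [h1 h2]; split=> [i|i j ij]; rewrite -!vw ?h1 ?h2. Qed.

End Rotating.

(** * Nonvanishing in the upper half-plane *)

Section RealRooted.
Variables (R : rcfType) (n' : nat) (z : R[i]).
Let n := n'.+1.
Let N := n.+1.
Hypothesis z_gt0 : 0 < complex.Im z.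

(** The factors of [chow_gen] act one at a time as windows. The first, of length [N], is treated
    apart: [residue_seq] has zeros, so [window_neq0] applies only after it. *)
Lemma pairing_chow_gen_neq0 i : pairing (chow_gen n') (residue_seq N z) i != 0.
Proof.
have N0 : (0 < N)%N by [].
pose v1 := pairing (qint N * 1) (residue_seq N z).
have E1 : window N (residue_seq N z) =1 v1.
  by move=> k; rewrite /v1 pairing_qint; apply: eq_window => l; rewrite pairing1.
have r1 : rotating N z v1 /\ forall k, v1 k != 0.
  split; last by move=> k; rewrite -E1 window_residue_neq0.
  by apply: (eq_rotating E1); apply/rotating_window_full/rotating_residue.
pose F m := qint n ^+ m * (qint N * (qint N * 1)).
suff [_ h] : rotating N z (pairing (F n') (residue_seq N z)) /\
    forall k, pairing (F n') (residue_seq N z) k != 0.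
  by rewrite (_ : chow_gen n' = F n') // /F /chow_gen mulr1 -expr2 mulrC.
elim: n' => [|m [rm nzm]].
  have E2 : window N v1 =1 pairing (F 0) (residue_seq N z).
    by move=> k; rewrite /F expr0 mul1r pairing_qint.
  case: r1 => r1 nz1; split; last by move=> k;
    rewrite -E2 (window_neq0 z_gt0 r1) // ltn0Sn leqnn.
  by apply: (eq_rotating E2); apply: rotating_window_full.
have E2 : window n (pairing (F m) (residue_seq N z)) =1 pairing (F m.+1) (residue_seq N z).
  by move=> k; rewrite /F exprS -mulrA pairing_qint.
split; last by move=> k; rewrite -E2 (window_neq0 z_gt0 rm) // ltn0Sn leqnSn.
by apply: (eq_rotating E2); apply: rotating_window_pred.
Qed.

(** Starting at [n = N - 1], the index [n + c] is a multiple of [N] exactly when [c = N e + 1], and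
    [residue_seq] is then [z^(e+1)]; this gives the residue 1 and the factor [z]. *)
Lemma pairing_residue (F : {poly int}) E : (size F <= N * E)%N ->
  pairing F (residue_seq N z) n = z * \sum_(e < E) (F`_(N * e + 1))%:~R * z ^+ e.
Proof.
move=> FE; rewrite (pairingE _ _ FE) {FE}.
elim: E => [|E IH]; first by rewrite muln0 big_geq // big_ord0 mulr0.
rewrite mulnS addnC (@big_cat_nat _ _ _ (N * E)) ?leq_addr //= {}IH big_ord_recr mulrDr
  /=; congr (_ + _).
rewrite (big_nat_single (k0 := (N * E + 1)%N)).
- have -> : (n + (N * E + 1) = E.+1 * N)%N by rewrite /N; nia.
  by rewrite /residue_seq dvdn_mull // mulnK // exprS mulrCA.
- by rewrite leq_addr ltn_add2l.
move=> k /andP[ek kE] kk; rewrite /residue_seq; case: ifP => [/dvdnP[a Ea]|];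
  last by rewrite mulr0.
have N0 : (0 < N)%N by [].
have Nn : N = n.+1 by [].
have h1 : (E < a)%N by rewrite -(ltn_pmul2r N0) -Ea mulnC; lia.
have h2 : (a < E.+2)%N by rewrite -(ltn_pmul2r N0) -Ea !mulSn (mulnC E); lia.
case/eqP: kk; move: Ea; have -> : a = E.+1 by lia.
by rewrite mulSn mulnC; lia.
Qed.

Lemma chow_nc_horner_neq0 : (map_poly intr (chow_poly (NC N)) : {poly R[i]}).[z] != 0.
Proof.
apply/eqP => H0.
pose H := N%:R * chow_poly (NC N).
have {}H0 : (map_poly intr H : {poly R[i]}).[z] = 0.
  by rewrite /H rmorphM rmorph_nat hornerM H0 mulr0.
(* Large enough both for evaluating [H] by its first [E] coefficients and for [N * E] to bound the
   size of [chow_gen]. *)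
pose E := (size H + size (chow_gen n'))%N.
have Hz : (map_poly intr H : {poly R[i]}).[z] =
    \sum_(e < E) ((chow_gen n')`_(N * e + 1))%:~R * z ^+ e.
  rewrite (@horner_coef_wide _ E); last by rewrite (leq_trans (size_poly _ _)) // leq_addr.
  by apply: eq_bigr => e _; rewrite coef_map /= chow_nc_coef.
have := pairing_chow_gen_neq0 n.
rewrite (@pairing_residue _ E) -?Hz ?H0 ?mulr0 ?eqxx // /E mulnDr.
by apply: leq_trans (leq_addl _ _); rewrite leq_pmull.
Qed.

End RealRooted.

Theorem theorem1p1 (R : realType) (n : nat) (hn : (1 <= n)%N) :
  real_rooted R (chow_poly (NC n.+1)).
Proof.
case: n hn => // n _ z; set p := map_poly intr _ => pz.
case: (ltgtP (complex.Im z) 0) => [z0|z0|z0].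
(* The coefficients are integers, so a root in the lower half-plane has its conjugate as a root in
   the upper one. *)
- have r : root p z^*%C.
    rewrite -complex_root_conj -map_poly_comp (@eq_map_poly _ _ _ intr) //.
    by move=> k; rewrite /= rmorph_int.
  have zc : 0 < complex.Im z^*%C by case: z z0 {pz r} => a b /=; rewrite oppr_gt0.
  by have := chow_nc_horner_neq0 n zc; rewrite -/p (rootP r) eqxx.
- by have := chow_nc_horner_neq0 n z0; rewrite -/p (rootP pz) eqxx.
- by case: z z0 {pz} => a b /= ->; rewrite complex_real.
Qed.
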